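(* Let $n\ge1$ and let $f\in\mathcal{C}^{2}(\mathbb{B}^{n})$ satisfy $\mathrm{Re}\big(f\overline{\Delta f}\big)\ge0$ in $\mathbb{B}^n$. Then for $p\ge2$ and $\alpha\ge2$, $$\int_{\mathbb{B}^{n}}(1-|z|^{2})^{\alpha}\,\Delta\big(|f(z)|^{p}\big)\,dV_{N}(z)<\infty$$ if and only if $f\in b_{\alpha-2,p}(\mathbb{B}^{n})$.
   Context: $\mathbb{B}^n$ is the open unit ball of $\mathbb{C}^n$, $d(z)=1-|z|$, $dV_N$ the normalized volume measure, $\Delta=4\sum_k\partial^2/\partial z_k\partial\overline{z}_k$. For $\nu>-1$ and $0<\mu<\infty$, the Bergman-type space $b_{\nu,\mu}(\mathbb{B}^n)$ consists of all continuous complex-valued $f$ on $\mathbb{B}^n$ with $\int_{\mathbb{B}^n}d(z)^{\nu}|f(z)|^{\mu}\,dV_N(z)<\infty$ (norm $|f(0)|+(\int_{\mathbb{B}^n}d^\nu|f|^\mu dV_N)^{1/\mu}$). *)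

(* Defs.v *)
From HB Require Import structures.
From mathcomp Require Import all_boot all_order all_algebra.
From mathcomp Require Import all_classical all_reals all_analysis.
Set Implicit Arguments. Unset Strict Implicit. Unset Printing Implicit Defensive.
Import Order.TTheory GRing.Theory Num.Theory.
Import numFieldNormedType.Exports.
Local Open Scope classical_set_scope.
Local Open Scope ring_scope.

(* C^n is identified with R^(2n) = 'rV[R]_(2n) (real and imaginary parts of
   the coordinates); a complex-valued function f is given by its real part u
   and imaginary part v. *)

Section Defs.
Variables (R : realType) (m : nat).

Definition normsq (x : 'rV[R]_m) : R := \sum_(i < m) x ord0 i ^+ 2.

Definition enorm (x : 'rV[R]_m) : R := Num.sqrt (normsq x).

Definition eball : set 'rV[R]_m := [set x | normsq x < 1].

Definition unitv (i : 'I_m) : 'rV[R]_m := delta_mx ord0 i.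

Definition partial (i : 'I_m) (g : 'rV[R]_m -> R) (x : 'rV[R]_m) : R :=
  'D_(unitv i) g x.

(* Laplacian: Delta = 4 sum_k d^2/dz_k dzbar_k = sum over real coordinates
   of the second partial derivatives *)
Definition lap (g : 'rV[R]_m -> R) (x : 'rV[R]_m) : R :=
  \sum_(i < m) partial i (partial i g) x.

Definition C2_on (A : set 'rV[R]_m) (g : 'rV[R]_m -> R) : Prop :=
  forall x, A x ->
    [/\ {for x, continuous g},
        forall i, derivable g x (unitv i) /\ {for x, continuous (partial i g)}
      & forall i j, derivable (partial i g) x (unitv j) /\
                    {for x, continuous (partial j (partial i g))}].

(* the measurable space R^m is m.-tuple R (product Borel sigma-algebra) *)
Definition rv_of_tuple (t : m.-tuple R) : 'rV[R]_m := \row_i tnth t i.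

Definition tball : set (m.-tuple R) := rv_of_tuple @^-1` eball.

(* mu is the normalized volume measure dV_N: a positive multiple of the
   Lebesgue measure (on boxes) giving the unit ball measure 1 *)
Definition is_dVN (mu : {measure set (m.-tuple R) -> \bar R}) : Prop :=
  mu tball = 1%E /\
  exists c : R, 0 < c /\
    forall a b : m.-tuple R, (forall i, tnth a i <= tnth b i) ->
      mu [set t | forall i, tnth a i <= tnth t i <= tnth b i] =
        (c * \prod_(i < m) (tnth b i - tnth a i))%:E.

Definition cabs (u v : 'rV[R]_m -> R) (x : 'rV[R]_m) : R :=
  Num.sqrt (u x ^+ 2 + v x ^+ 2).

Definition in_b (mu : {measure set (m.-tuple R) -> \bar R}) (nu mu' : R)
    (u v : 'rV[R]_m -> R) : Prop :=
  (forall x, eball x -> {for x, continuous u} /\ {for x, continuous v}) /\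
  (\int[mu]_(t in tball)
      (((1 - enorm (rv_of_tuple t)) `^ nu) *
        (cabs u v (rv_of_tuple t) `^ mu'))%:E < +oo)%E.

End Defs.

(* Main.v *)
(** Write F = |f|^p. As p >= 2, F is twice continuously differentiable along
    the coordinate axes, also at the zeros of f, and the sign hypothesis gives
    lap F >= 0. Put rho = (r - |x|^2)_+^b with r < 1 and b > 2; this weight is
    C^2 with compact support in the ball, so that
      int rho (lap F) = int (lap rho) F,
      wgt := lap rho = 4 b (b-1) |x|^2 (r - |x|^2)_+^(b-2) - 2 m b (r - |x|^2)_+^(b-1)
    in real dimension m. Each axis is treated separately: the i-th derivative
    of H = rho d_i F - F d_i rho has integral zero because the measure is
    translation invariant, so difference quotients of H integrate to zero, and
    dominated convergence applies.
    Near the sphere lap rho is bounded above and below by multiples of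
    (r - |x|^2)_+^(b-2), and away from it F is bounded. Letting r -> 1 and
    b -> alpha+ with Fatou's lemma gives both implications. Taking b > alpha
    (rather than b = alpha) keeps rho of class C^2 when alpha = 2. *)
Require Import Defs.
From HB Require Import structures.
From mathcomp Require Import all_boot all_order all_algebra.
From mathcomp Require Import all_classical all_reals all_analysis measurable_realfun.
From mathcomp Require Import ring lra.
Import Order.TTheory GRing.Theory Num.Theory.
Import numFieldNormedType.Exports.
Local Open Scope classical_set_scope.
Local Open Scope ring_scope.
Set Implicit Arguments.
Unset Strict Implicit.
Unset Printing Implicit Defensive.

(** * Translation invariance of the measure *)

(** Closed boxes are the sets whose measure [is_dVN] prescribes. A box is empty as soon as one lower
    bound exceeds the corresponding upper bound, a case that the lemmas on boxes treat
    separately. *)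
Definition tbox (R : realType) (m : nat) (a b : m.-tuple R) : set (m.-tuple R) :=
  [set t | forall i, tnth a i <= tnth t i <= tnth b i].

Definition tshift (R : realType) (m : nat) (w : 'rV[R]_m) (t : m.-tuple R) :
  m.-tuple R := [tuple tnth t i + w ord0 i | i < m].

Lemma rv_of_tuple_shift (R : realType) (m : nat) (w : 'rV[R]_m) (t : m.-tuple R) :
  rv_of_tuple (tshift w t) = rv_of_tuple t + w.
Proof. by apply/rowP => i; rewrite !mxE tnth_mktuple. Qed.

Lemma measurable_tnth_preimage (R : realType) (m : nat) (i : 'I_m) (B : set R) :
  measurable B -> measurable [set t : m.-tuple R | B (tnth t i)].
Proof.
move=> mB; have := @measurable_tnth _ R m i measurableT B mB.
by rewrite setTI.
Qed.

Lemma tbox_measurable (R : realType) (m : nat) (a b : m.-tuple R) :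
  measurable (tbox a b).
Proof.
rewrite (_ : tbox a b = \big[setI/setT]_(i <- index_enum 'I_m)
    [set t : m.-tuple R | `[tnth a i, tnth b i]%classic (tnth t i)]).
  by apply: bigsetI_measurable => i _; exact: measurable_tnth_preimage.
rewrite -bigcap_seq; apply/seteqP; split => t /=.
  by move=> ht i _; rewrite /= in_itv /=; exact: ht.
by move=> ht i; have /= := ht i (mem_index_enum i); rewrite in_itv.
Qed.

Lemma tshift_measurable (R : realType) (m : nat) (w : 'rV[R]_m) :
  measurable_fun setT (tshift w).
Proof.
apply/measurable_fun_tnthP => i.
rewrite (_ : _ \o _ = (fun t : m.-tuple R => tnth t i + w ord0 i)); last first.
  by apply/funext => t /=; rewrite tnth_mktuple.
by apply: measurable_funD => //; exact: measurable_tnth.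
Qed.

(** The intersection takes maxima of lower corners and minima of upper corners. With this stability,
    boxes form a pi-system, as uniqueness of measures requires. *)
Lemma tboxI (R : realType) (m : nat) :
  setI_closed [set A : set (m.-tuple R) | exists a b, A = tbox a b].
Proof.
move=> _ _ [a [b ->]] [a' [b' ->]].
exists [tuple Num.max (tnth a i) (tnth a' i) | i < m].
exists [tuple Num.min (tnth b i) (tnth b' i) | i < m].
apply/seteqP; split => t /=.
  move=> [h h'] i; rewrite !tnth_mktuple ge_max le_min.
  have /andP[h1 h2] := h i; have /andP[h3 h4] := h' i.
  by rewrite h1 h2 /=; apply/andP.
move=> h; split => i; have := h i; rewrite !tnth_mktuple ge_max le_min;
  by case/andP => /andP[h1 h2] /andP[h3 h4]; apply/andP.
Qed.

Lemma tbox_cover (R : realType) (m : nat) :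
  \bigcup_k tbox [tuple - (k%:R : R) | i < m] [tuple k%:R | i < m] = setT.
Proof.
rewrite -subTset => t _.
(* An integer above the sum of all absolute values bounds every coordinate at once. *)
exists (Num.truncn (\sum_(i < m) `|tnth t i|)).+1 => // i.
rewrite !tnth_mktuple -ler_norml; apply: ltW.
apply: le_lt_trans (truncnS_gt _).
by rewrite (bigD1 i) //= lerDl sumr_ge0.
Qed.

(** The product sigma-algebra is the smallest one making all coordinates measurable, so it suffices
    that coordinates are measurable for the sigma-algebra generated by boxes. *)
Lemma measurable_tbox_generated (R : realType) (m : nat) :
  (measurable : set (set (m.-tuple R))) =
  <<s [set A | exists a b, A = tbox a b] >>.
Proof.
apply/seteqP; split; last first.
  apply: smallest_sub; first exact: sigma_algebra_measurable.
  by move=> _ [a [b ->]]; exact: tbox_measurable.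
set G := [set A | _].
have sG := smallest_sigma_algebra (@setT (m.-tuple R)) G.
suff mt (i : 'I_m) :
    measurable_fun (setT : set (g_sigma_algebraType G)) (fun t => tnth t i).
  apply: smallest_sub => // A; rewrite -bigcup_seq => -[i _ [B mB <-]].
  by have := mt i measurableT B mB.
apply: (measurability _ (RGenCInfty.measurableE R)).
move=> _ [_ [x ->] <-]; rewrite setTI.
(* The half-space of points whose i-th coordinate is at least x is a countable union of boxes: side
   i starts at x, the other sides at -k, and all sides end at k. *)
rewrite (_ : _ @^-1` _ = \bigcup_(k : nat)
    tbox [tuple if j == i then x else - (k%:R : R) | j < m] [tuple k%:R | j < m]).
  apply: bigcupT_measurable => k; apply: sub_sigma_algebra.
  by do 2 eexists; reflexivity.
apply/seteqP; split => t /=.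
  rewrite in_itv /= andbT => xt.
  exists (Num.truncn (\sum_(i < m) `|tnth t i|)).+1 => // j.
  rewrite !tnth_mktuple.
  have : `|tnth t j| <= (Num.truncn (\sum_(i < m) `|tnth t i|)).+1%:R.
    apply/ltW/(le_lt_trans _ (truncnS_gt _)).
    by rewrite (bigD1 j) //= lerDl sumr_ge0.
  rewrite ler_norml => /andP[h1 h2]; rewrite h2 andbT.
  by case: eqP => [->|].
move=> [k _ /(_ i)]; rewrite !tnth_mktuple eqxx in_itv /= => /andP[-> //].
Qed.

Lemma dVN_box (R : realType) (m : nat) (mu : {measure set (m.-tuple R) -> \bar R}) :
  is_dVN mu -> forall a b, (mu (tbox a b) < +oo)%E.
Proof.
move=> [_ [c [c0 hc]]] a b.
case: (pselect (forall i, tnth a i <= tnth b i)) => [ab|nab].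
  by rewrite (hc _ _ ab) ltry.
rewrite (_ : tbox a b = set0) ?measure0 ?ltry// -subset0 => t ht; apply: nab => i.
by have /andP[h1 h2] := ht i; exact: le_trans h2.
Qed.

Lemma tshift_tbox (R : realType) (m : nat) (w : 'rV[R]_m) (a b : m.-tuple R) :
  tshift w @^-1` tbox a b =
  tbox [tuple tnth a i - w ord0 i | i < m] [tuple tnth b i - w ord0 i | i < m].
Proof.
apply/seteqP; split => t /= ht i; have := ht i;
  by rewrite !tnth_mktuple lerBlDr lerBrDr.
Qed.

(** The volume of a box depends only on its side lengths, which a translation preserves; if the
    corners are in the wrong order, both boxes are empty. *)
Lemma dVN_shift_tbox (R : realType) (m : nat)
    (mu : {measure set (m.-tuple R) -> \bar R}) (w : 'rV[R]_m) (a b : m.-tuple R) :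
  is_dVN mu -> mu (tshift w @^-1` tbox a b) = mu (tbox a b).
Proof.
move=> [_ [c [c0 hc]]]; rewrite tshift_tbox.
have [ab|nab] := pselect (forall i, tnth a i <= tnth b i).
  rewrite !hc//; last by move=> i; rewrite !tnth_mktuple lerB.
  congr (_ * _)%:E; apply: eq_bigr => i _; rewrite !tnth_mktuple; ring.
have -> : tbox a b = set0.
  rewrite -subset0 => t ht; apply: nab => i.
  by have /andP[h1 h2] := ht i; exact: le_trans h2.
set S := tbox _ _; have -> : S = set0; last by [].
rewrite -subset0 => t ht; apply: nab => i.
have := ht i; rewrite !tnth_mktuple => /andP[h1 h2].
by have := le_trans h1 h2; rewrite lerD2r.
Qed.

(** The measure and its image under the translation agree on boxes, a generating pi-system that
    contains an exhaustion of the space by sets of finite measure; hence they coincide. *)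
Lemma dVN_shift (R : realType) (m : nat) (mu : {measure set (m.-tuple R) -> \bar R})
    (w : 'rV[R]_m) (A : set (m.-tuple R)) :
  is_dVN mu -> measurable A -> mu (tshift w @^-1` A) = mu A.
Proof.
move=> dmu mA.
apply: (measure_unique [set A | exists a b, A = tbox a b]
  (fun k : nat => tbox [tuple - (k%:R : R) | i < m] [tuple k%:R | i < m])
  _ _ _ _ (pushforward mu (tshift w)) mu) => //.
- exact: measurable_tbox_generated.
- exact: tboxI.
- by move=> k; do 2 eexists; reflexivity.
- exact: tbox_cover.
- exact: tshift_measurable.
- by move=> ? _ [a [b ->]]; exact: dVN_shift_tbox.
- move=> ? k; apply: le_lt_trans (dVN_box dmu _ _).
  by rewrite le_eqVlt; apply/orP; left; apply/eqP; exact: dVN_shift_tbox.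
Qed.

(** The norm on row vectors is the sup norm, so an open set is the union of the countably many cubes
    with rational centre and half-side 1/(k+1) that it contains. This connects the topology on row
    vectors with the sigma-algebra on tuples. *)
Lemma open_rv_measurable (R : realType) (m : nat) (U : set 'rV[R]_m) :
  open U -> measurable (@rv_of_tuple R m @^-1` U).
Proof.
move=> oU.
pose B (z : (m.-tuple rat * nat)%type) : set (m.-tuple R) :=
  tbox [tuple ratr (tnth z.1 i) - z.2.+1%:R^-1 | i < m]
       [tuple ratr (tnth z.1 i) + z.2.+1%:R^-1 | i < m].
pose F z := if `[< B z `<=` @rv_of_tuple R m @^-1` U >] then B z else set0.
rewrite (_ : _ @^-1` _ = \bigcup_z F z).
  apply: countable_bigcupT_measurable => [|z]; first exact: countableP.
  by rewrite /F; case: ifP => _ //; exact: tbox_measurable.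
apply/seteqP; split; last first.
  by move=> t [z _]; rewrite /F; case: asboolP => // h; exact: h.
move=> t Ut.
have /nbhs_ballP[e /= e0 he] : nbhs (rv_of_tuple t) U by exact: open_nbhs_nbhs.
(* Two points of a cube of half-side 1/(k+1) differ by at most 2/(k+1) in each coordinate, hence the
   factor 2. *)
have [k ke] : exists k, 2 * k.+1%:R^-1 < e.
  exists (Num.truncn (2 / e)).
  by rewrite ltr_pdivrMr// mulrC -ltr_pdivrMr// truncnS_gt.
have k0 : 0 < (k.+1%:R^-1 : R) by rewrite invr_gt0.
have hq (i : 'I_m) : exists q : rat,
    ratr q \in `](tnth t i - k.+1%:R^-1), (tnth t i + k.+1%:R^-1)[.
  by apply: rat_in_itvoo; rewrite ltrD2l; exact: lt_trans k0; rewrite oppr_lt0.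
have [q qP] := choice hq.
set d : R := k.+1%:R^-1 in ke k0 hq qP.
have tB : B ([tuple q i | i < m], k) t.
  move=> i; have := qP i; rewrite !tnth_mktuple -/d.
  rewrite in_itv /= => /andP[h1 h2]; apply/andP; split; lra.
exists ([tuple q i | i < m], k) => //; rewrite /F; case: asboolP => //; case.
move=> s sB; apply: he; split => // i j; rewrite ord1 /ball /= !mxE.
have := qP j; have := sB j; rewrite !tnth_mktuple -/d in_itv /=.
by move=> /andP[h1 h2] /andP[h3 h4]; rewrite ltr_norml; apply/andP; split; lra.
Qed.

Lemma continuous_rv_measurable (R : realType) (m : nat) (D : set 'rV[R]_m)
    (g : 'rV[R]_m -> R) :
  open D -> (forall x, D x -> {for x, continuous g}) ->
  measurable_fun (@rv_of_tuple R m @^-1` D) (g \o @rv_of_tuple R m).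
Proof.
move=> oD cg.
apply: (measurability _ (RGenOInfty.measurableE R)).
move=> _ [_ [x ->] <-].
apply: (@open_rv_measurable _ _ (D `&` g @^-1` `]x, +oo[%classic)).
rewrite openE => y [Dy /=]; rewrite in_itv /= andbT => gy.
apply: filterI; first exact: open_nbhs_nbhs.
have := cg y Dy; move=> /cvgr_gt /(_ _ gy); apply: filterS => z /=.
by rewrite in_itv /= andbT.
Qed.

Lemma coord_norm_le (R : realType) (m : nat) (w : 'rV[R]_m) (i : 'I_m) :
  `|w ord0 i| <= `|w|.
Proof.
by rewrite [leRHS]/Num.norm /= mx_normrE; apply: (le_bigmax _ _ (ord0, i)).
Qed.

(** The function is bounded on a compact cube, which has finite measure, and vanishes outside it. *)
Lemma continuous_supp_integrable (R : realType) (m : nat)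
    (mu : {measure set (m.-tuple R) -> \bar R}) (g : 'rV[R]_m -> R) (K : R) :
  is_dVN mu -> continuous g -> (forall (x : 'rV[R]_m) i, K < `|x ord0 i| -> g x = 0) ->
  mu.-integrable setT (EFin \o g \o @rv_of_tuple R m).
Proof.
move=> dmu cg g0.
pose C : set 'rV[R]_m := [set x | forall i, x ord0 i \in `[(- K), K]].
have cC : compact C.
  by apply: (@rV_compact _ _ (fun=> `[(- K), K]%classic)) => _; exact: segment_compact.
have CP x : ~ C x -> g x = 0.
  move=> /existsNP[i]; rewrite in_itv /= -ler_norml => /negP.
  by rewrite -ltNge; exact: g0.
have tE : @rv_of_tuple R m @^-1` C = tbox [tuple - K | i < m] [tuple K | i < m].
  apply/seteqP; split => t /= ht i; have := ht i;
    by rewrite !tnth_mktuple in_itv /= mxE.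
have mg : measurable_fun setT (g \o @rv_of_tuple R m).
  by apply: (@continuous_rv_measurable _ _ setT); [exact: openT|move=> x _; exact: cg].
have mC : measurable (@rv_of_tuple R m @^-1` C) by rewrite tE; exact: tbox_measurable.
have : mu.-integrable (@rv_of_tuple R m @^-1` C) (EFin \o (g \o @rv_of_tuple R m)).
  apply: measurable_bounded_integrable => //.
  - by rewrite tE; exact: dVN_box.
  - exact: measurable_funTS.
  have /compact_bounded[M [Mr hM]] : compact (g @` C).
    by apply: continuous_compact => //; exact: continuous_subspaceT.
  by exists M; split => // N MN t Ct; apply: hM => //; exists (rv_of_tuple t).
move/(integrable_mkcond _ mC); congr (integrable _ _ _).
apply/funext => t /=; rewrite patchE; case: ifPn => //.
by rewrite notin_setE => nC; rewrite /= CP.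
Qed.

Lemma addr_continuous (R : realType) (V : normedModType R) (w : V) :
  continuous (fun x : V => x + w).
Proof.
by move=> x; apply: (@cvgD _ _ _ _ _ (fun x : V => x) (cst w)); [exact: cvg_id|exact: cvg_cst].
Qed.

Lemma integral_shift (R : realType) (m : nat)
    (mu : {measure set (m.-tuple R) -> \bar R}) (g : 'rV[R]_m -> R) (K : R)
    (w : 'rV[R]_m) :
  is_dVN mu -> continuous g -> (forall (x : 'rV[R]_m) i, K < `|x ord0 i| -> g x = 0) ->
  (\int[mu]_t (g (rv_of_tuple t + w))%:E = \int[mu]_t (g (rv_of_tuple t))%:E)%E.
Proof.
move=> dmu cg g0.
have mg : measurable_fun setT (g \o @rv_of_tuple R m).
  by apply: (@continuous_rv_measurable _ _ setT); [exact: openT|move=> x _; exact: cg].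
(* Change of variables: the integral of a translate is an integral against the image measure, and
   this measure is [mu] itself. *)
transitivity (\int[pushforward mu (tshift w)]_t (g (rv_of_tuple t))%:E)%E; last first.
  pose pm := measure_function_pushforward__canonical__measure_function_Measure mu
    (tshift_measurable w).
  apply: (@eq_measure_integral _ _ R setT mu pm) => A mA _.
  exact: (dVN_shift w dmu mA).
have cgw : continuous (fun x : 'rV[R]_m => g (x + w)).
  move=> x; apply: (@continuous_comp _ _ _ (fun x : 'rV[R]_m => x + w) g); last exact: cg.
  exact: addr_continuous.
rewrite (integral_pushforward (tshift_measurable w)) //.
- by apply: eq_integral => t _ /=; rewrite rv_of_tuple_shift.
- exact/measurable_EFinP.
rewrite preimage_setT.
have ig : mu.-integrable setT
    ((EFin \o (fun x => g (x + w))) \o @rv_of_tuple R m).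
  (* Translating by w moves each coordinate by at most the norm of w, so the support cube grows by
     that amount. *)
  apply: (continuous_supp_integrable (K := K + `|w|) dmu cgw) => x i h.
  apply: (g0 _ i); rewrite mxE.
  have hw : `|w ord0 i| <= `|w| by exact: coord_norm_le.
  have := ler_normB (x ord0 i + w ord0 i) (w ord0 i); rewrite addrK; lra.
rewrite (_ : _ \o tshift w = (EFin \o (fun x => g (x + w))) \o @rv_of_tuple R m)//.
by apply/funext => t /=; rewrite rv_of_tuple_shift.
Qed.

(** * Pointwise continuity rules and restriction to lines *)

Lemma continuous_add (R : realType) (T : topologicalType) (f g : T -> R) (x : T) :
  {for x, continuous f} -> {for x, continuous g} ->
  {for x, continuous (fun y => f y + g y)}.
Proof. by move=> cf cg; exact: (continuousD cf cg). Qed.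

Lemma continuous_sub (R : realType) (T : topologicalType) (f g : T -> R) (x : T) :
  {for x, continuous f} -> {for x, continuous g} ->
  {for x, continuous (fun y => f y - g y)}.
Proof. by move=> cf cg; exact: (continuousB cf cg). Qed.

Lemma continuous_mul (R : realType) (T : topologicalType) (f g : T -> R) (x : T) :
  {for x, continuous f} -> {for x, continuous g} ->
  {for x, continuous (fun y => f y * g y)}.
Proof. by move=> cf cg; exact: (continuousM cf cg). Qed.

Lemma continuous_opp (R : realType) (T : topologicalType) (f : T -> R) (x : T) :
  {for x, continuous f} -> {for x, continuous (fun y => - f y)}.
Proof. by move=> cf; exact: (continuousN cf). Qed.

Lemma near_eq_continuous (R : realType) (T : topologicalType) (f g : T -> R) (x : T) :
  (\forall y \near x, f y = g y) -> {for x, continuous f} -> {for x, continuous g}.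
Proof.
move=> E cf; rewrite /prop_for /continuous_at -(nbhs_singleton E).
exact: (cvg_trans (near_eq_cvg E)).
Qed.

Lemma continuous_const (R : realType) (T : topologicalType) (c : R) (x : T) :
  {for x, continuous (fun _ : T => c)}.
Proof. exact: cst_continuous. Qed.

Lemma continuous_bigsum (R : realType) (T : topologicalType) (m : nat)
    (f : 'I_m -> T -> R) (x : T) :
  (forall i, {for x, continuous (f i)}) ->
  {for x, continuous (fun y => \sum_(i < m) f i y)}.
Proof.
elim: m f => [|m IH] f cf.
  rewrite (_ : (fun _ => _) = (fun=> 0)); last by apply/funext => y; rewrite big_ord0.
  exact: continuous_const.
rewrite (_ : (fun _ => _) = (fun y => f ord0 y + \sum_(i < m) f (lift ord0 i) y)).
  by apply: continuous_add => //; exact: IH.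
by apply/funext => y; rewrite big_ord_recl.
Qed.

(** A directional derivative is an ordinary derivative along a line; this makes the one-variable
    mean value theorem and chain rule available. *)
Lemma is_derive_line (R : realType) (V : normedModType R) (g : V -> R) (x v : V) (s d : R) :
  is_derive (s *: v + x) v g d -> is_derive s 1 (fun s => g (s *: v + x)) d.
Proof.
move=> [dg <-].
have E : (fun h => h^-1 *: ((g \o shift (s *: v + x)) (h *: v) - g (s *: v + x))) =
  (fun h : R => h^-1 *: (((fun s => g (s *: v + x)) \o shift s) (h *: (1 : R^o)) - g (s *: v + x))).
  apply/funext => h /=; congr (_ *: (g _ - _)).
  by rewrite /GRing.scale /= mulr1 addrA -scalerDl.
split; first by rewrite /derivable -E.
by rewrite /derive -E.
Qed.

Lemma continuous_supp_bounded (R : realType) (m : nat) (g : 'rV[R]_m -> R) (K : R) :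
  continuous g -> (forall (x : 'rV[R]_m) i, K < `|x ord0 i| -> g x = 0) ->
  exists2 M, 0 <= M & forall x, `|g x| <= M.
Proof.
move=> cg g0.
pose C : set 'rV[R]_m := [set x | forall i, x ord0 i \in `[(- K), K]].
have cC : compact C.
  by apply: (@rV_compact _ _ (fun=> `[(- K), K]%classic)) => _; exact: segment_compact.
have /compact_bounded[M [Mr hM]] : compact (g @` C).
  by apply: continuous_compact => //; exact: continuous_subspaceT.
exists (`|M| + 1) => [|x]; first by rewrite addr_ge0.
have [Cx|/existsNP[i]] := pselect (C x).
  apply: (hM (`|M| + 1)); last by exists x.
  by rewrite (le_lt_trans (ler_norm M))// ltrDl.
rewrite in_itv /= -ler_norml => /negP; rewrite -ltNge => /g0 ->.
by rewrite normr0 addr_ge0.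
Qed.

Lemma partial_increment_le (R : realType) (m : nat) (H dH : 'rV[R]_m -> R)
    (v : 'rV[R]_m) (M : R) :
  continuous H -> (forall x, is_derive x v H (dH x)) ->
  (forall x, `|dH x| <= M) ->
  forall x h, 0 < h -> `|H (x + h *: v) - H x| <= M * h.
Proof.
move=> cH dHP hM x h h0.
have [||c _] := @MVT R (fun s => H (s *: v + x)) (fun s => dH (s *: v + x)) 0 h h0.
- by move=> s _; exact: is_derive_line.
- apply: continuous_subspaceT => s.
  apply: (@continuous_comp _ _ _ (fun s : R => s *: v + x) H); last exact: cH.
  by apply: cvgD; [exact: scalel_continuous|exact: cvg_cst].
rewrite subr0 scale0r add0r (addrC _ x) => ->.
by rewrite normrM (gtr0_norm h0) ler_wpM2r// ltW.
Qed.

(** The derivative is the limit of difference quotients, and each of these has integral zero because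
    H and its translate have the same integral. The mean value theorem and the bounded support give
    the dominating function. *)
Lemma integral_partial_eq0 (R : realType) (m : nat)
    (mu : {measure set (m.-tuple R) -> \bar R}) (H dH : 'rV[R]_m -> R) (i : 'I_m)
    (K : R) :
  is_dVN mu -> continuous H -> continuous dH ->
  (forall x, is_derive x (unitv R i) H (dH x)) ->
  (forall (x : 'rV[R]_m) j, K < `|x ord0 j| -> H x = 0) ->
  (forall (x : 'rV[R]_m) j, K < `|x ord0 j| -> dH x = 0) ->
  (\int[mu]_t (dH (rv_of_tuple t))%:E = 0)%E.
Proof.
move=> dmu cH cdH dHP H0 dH0.
have [M M0 hM] := continuous_supp_bounded cdH dH0.
have [e eE] : exists e : 'rV[R]_m, e = unitv R i by exists (unitv R i).
(* The step 1/(k+1) never exceeds 1, so all the quotients vanish outside one cube, of half-side |K|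
   + 1. *)
pose D k (x : 'rV[R]_m) : R := k.+1%:R * (H (x + k.+1%:R^-1 *: e) - H x).
have ej j : `|e ord0 j| <= 1.
  by rewrite eE /unitv mxE eqxx; case: eqP; rewrite ?normr1 ?normr0.
have inv01 k : 0 < (k.+1%:R^-1 : R) <= 1.
  by rewrite invr_gt0 ltr0Sn /= invf_le1// ler1n.
have Dsupp k (x : 'rV[R]_m) j : `|K| + 1 < `|x ord0 j| -> D k x = 0.
  move=> hj; have KK := ler_norm K.
  rewrite /D (H0 x j) ?(H0 (x + _) j) ?subrr ?mulr0//; last by lra.
  rewrite !mxE.
  have h1 : `|k.+1%:R^-1 * e ord0 j| <= 1.
    have /andP[a0 a1] := inv01 k.
    by rewrite normrM (gtr0_norm a0) mulr_ile1// ltW.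
  have := ler_normB (x ord0 j + k.+1%:R^-1 * e ord0 j) (k.+1%:R^-1 * e ord0 j).
  rewrite addrK; lra.
have DM k x : `|D k x| <= M.
  have /andP[a0 a1] := inv01 k.
  rewrite /D normrM (ger0_norm (ler0n _ _)) -ler_pdivlMl ?ltr0Sn// mulrC.
  by apply: (partial_increment_le cH _ hM) => // y; rewrite eE.
have cshift (w : 'rV[R]_m) : continuous (fun x : 'rV[R]_m => H (x + w)).
  move=> x; apply: (@continuous_comp _ _ _ (fun x : 'rV[R]_m => x + w) H); last exact: cH.
  exact: addr_continuous.
have cD k : continuous (D k).
  move=> x.
  suff : {for x, continuous (fun x : 'rV[R]_m => k.+1%:R * (H (x + k.+1%:R^-1 *: e) - H x))} by [].
  apply: continuous_mul; first exact: continuous_const.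
  by apply: continuous_sub; [exact: cshift|exact: cH].
have D_cvg x : D k x @[k --> \oo] --> dH x.
  have [dx <-] := dHP x.
  have /cvgr_dnbhsP : (h^-1 *: ((H \o shift x) (h *: e) - H x)) @[h --> 0^'] -->
      'D_(unitv R i) H x by rewrite -eE in dx *; exact: dx.
  move=> /(_ (fun k => k.+1%:R^-1)) hcvg.
  rewrite (_ : (fun k => D k x) = fun k : nat => (k.+1%:R^-1)^-1 *:
      ((H \o shift x) (k.+1%:R^-1 *: e) - H x)); last first.
    by apply/funext => k; rewrite /D /= invrK (addrC _ x).
  apply: hcvg; split; first by move=> k; rewrite invr_neq0.
  exact: cvg_harmonic.
have mDk k : measurable_fun setT (D k \o @rv_of_tuple R m).
  by apply: (@continuous_rv_measurable _ _ setT); [exact: openT|move=> x _; exact: cD].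
have mdH : measurable_fun setT (dH \o @rv_of_tuple R m).
  by apply: (@continuous_rv_measurable _ _ setT); [exact: openT|move=> x _; exact: cdH].
pose B : set (m.-tuple R) := tbox [tuple - (`|K| + 1) | j < m] [tuple `|K| + 1 | j < m].
have mB : measurable B by exact: tbox_measurable.
have iB : mu.-integrable setT ((EFin \o cst M) \_ B).
  apply: (integrable_mkcond _ mB).1.
  apply: (measurable_bounded_integrable mB) => //; first exact: dVN_box.
  exact: bounded_cst.
have D_int k : (\int[mu]_t (D k (rv_of_tuple t))%:E = 0)%E.
  pose w := k.+1%:R^-1 *: e.
  have iH := continuous_supp_integrable dmu cH H0.
  have iHw : mu.-integrable setT (fun t => (H (rv_of_tuple t + w))%:E).
    apply: (@continuous_supp_integrable _ _ _ (fun x : 'rV[R]_m => H (x + w)) (K + `|w|)) => //.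
    move=> x j h; apply: (H0 _ j); rewrite mxE.
    have hw : `|w ord0 j| <= `|w| by exact: coord_norm_le.
    have := ler_normB (x ord0 j + w ord0 j) (w ord0 j); rewrite addrK; lra.
  under eq_integral do rewrite /D EFinM EFinB.
  rewrite integralZl//; last exact: integrableB.
  by rewrite integralB_EFin// (integral_shift w dmu cH H0) subee ?mule0//;
    exact: integrable_fin_num.
(* The dominating function is the bound M of the derivative, cut off to the common support cube. *)
have [|||||_ _ /=] := @dominated_convergence _ _ _ mu setT measurableT
  (fun k t => (D k (rv_of_tuple t))%:E) (fun t => (dH (rv_of_tuple t))%:E)
  ((EFin \o cst M) \_ B).
- by move=> k; move/measurable_EFinP : (mDk k).
- by move/measurable_EFinP : mdH.
- by apply: aeW => t _; apply: cvg_EFin => //; [exact: nearW|exact: D_cvg].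
- by [].
- apply: aeW => t k _ /=; rewrite patchE; case: ifPn => [_|].
    by rewrite lee_fin.
  rewrite notin_setE => /existsNP[j]; rewrite !tnth_mktuple -ler_norml => /negP.
  rewrite -ltNge => hj; rewrite (Dsupp _ _ j) ?mxE//.
  by rewrite normr0.
under eq_fun do rewrite D_int.
by move=> /cvg_lim <- //; rewrite lim_cst.
Qed.

(** * Differentiation along a direction *)

Lemma is_derive_cvg (R : realType) (V : normedModType R) (g : V -> R) (x v : V)
    (k : R -> R) (d : R) :
  k h @[h --> 0^'] --> d ->
  (forall h, h != 0 -> h^-1 * (g (h *: v + x) - g x) = k h) ->
  is_derive x v g d.
Proof.
move=> kd gk.
have q : (fun h => h^-1 *: ((g \o shift x) (h *: v) - g x)) @ 0^' --> d.
  apply: cvg_trans kd; apply: near_eq_cvg.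
  by near=> h; rewrite -gk//; near: h; exact: nbhs_dnbhs_neq.
by split; [apply/cvg_ex; exists d|exact: cvg_lim].
Unshelve. all: by end_near. Qed.

Lemma is_derive_quot (R : realType) (V : normedModType R) (g : V -> R) (x v : V) (d : R) :
  is_derive x v g d -> h^-1 * (g (h *: v + x) - g x) @[h --> 0^'] --> d.
Proof. by move=> [dg <-]; exact: dg. Qed.

Lemma cvg_line (R : realType) (V : normedModType R) (g : V -> R) (x v : V) :
  {for x, continuous g} -> g (h *: v + x) @[h --> 0^'] --> g x.
Proof.
move=> cg; have h0 : (0 : R) *: v + x = x by rewrite scale0r add0r.
have cl : {for (0 : R), continuous (fun h : R => h *: v + x)}.
  by apply: cvgD; [exact: scalel_continuous|exact: cvg_cst].
have cc : {for (0 : R), continuous (fun h : R => g (h *: v + x))}.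
  by apply: (continuous_comp cl); rewrite h0.
rewrite -[X in _ --> g X]h0; apply: (cvg_trans _ cc).
by apply: cvg_app; exact: nbhs_dnbhs.
Qed.

(** As B vanishes at x, the quotient of the product is A(x + hv) times the quotient of B and tends
    to A(x) b = 0. Since A is only continuous, this covers powers at points where they may fail to
    be differentiable. *)
Lemma is_derive_mul_zero (R : realType) (V : normedModType R) (A B : V -> R) (x v : V)
    (b : R) :
  {for x, continuous A} -> A x = 0 -> is_derive x v B b -> B x = 0 ->
  is_derive x v (fun y => A y * B y) 0.
Proof.
move=> cA A0 dB B0.
apply: (@is_derive_cvg _ _ _ _ _ (fun h => A (h *: v + x) *
    (h^-1 * (B (h *: v + x) - B x)))).
  rewrite -[X in _ --> X](mul0r b) -[X in X * b]A0.
  by apply: cvgM; [exact: cvg_line|exact: is_derive_quot].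
by move=> h _; rewrite B0 mulr0 !subr0 mulrCA.
Qed.

Lemma is_derive_chain (R : realType) (V : normedModType R) (s : V -> R) (phi : R -> R)
    (x v : V) (ds dphi : R) :
  is_derive x v s ds -> is_derive (s x) 1 phi dphi ->
  is_derive x v (fun y => phi (s y)) (dphi * ds).
Proof.
move=> hs hphi.
pose l (h : R) := s (h *: v + x).
have l0 : l 0 = s x by rewrite /l scale0r add0r.
have dl : is_derive (0 : R) 1 l ds.
  by apply: is_derive_line; rewrite scale0r add0r.
have dp : is_derive (l 0) 1 phi dphi by rewrite l0.
have dc : is_derive (0 : R) 1 (phi \o l) (dphi * ds) by exact: is_derive1_comp.
apply: (is_derive_cvg (is_derive_quot dc)) => h _ /=.
by rewrite addr0 l0 /l [h *: 1]mulr1.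
Qed.

(* The truncation at 0 matters: powR s q = 1 for s < 0. *)
Definition ppow (R : realType) (q s : R) : R := Num.max s 0 `^ q.

Lemma ppow_ge0 (R : realType) (q s : R) : 0 <= ppow q s.
Proof. exact: powR_ge0. Qed.

Lemma ppow_pos (R : realType) (q s : R) : 0 <= s -> ppow q s = s `^ q.
Proof. by move=> s0; rewrite /ppow max_l. Qed.

Lemma ppow_neg (R : realType) (q s : R) : q != 0 -> s <= 0 -> ppow q s = 0.
Proof. by move=> q0 s0; rewrite /ppow max_r// powR0. Qed.

Lemma powR_continuous (R : realType) (q s : R) :
  0 < s -> {for s, continuous (fun x => x `^ q)}.
Proof.
move=> s0; apply: differentiable_continuous; apply/derivable1_diffP.
by apply: derivable_powR; rewrite in_itv /= s0.
Qed.

Lemma ppow_continuous (R : realType) (q : R) : 0 < q -> continuous (ppow q).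
Proof.
move=> q0 s; case: (ltgtP s 0) => [s0|s0|->].
- have E : \forall x \near s, cst 0 x = ppow q x.
    near=> x; rewrite ppow_neg// ?gt_eqF//; apply: ltW.
    by near: x; exact: lt_nbhsl.
  rewrite /continuous_at ppow_neg ?gt_eqF// 1?ltW//.
  by apply: (cvg_trans (near_eq_cvg E)); exact: cvg_cst.
- have E : \forall x \near s, x `^ q = ppow q x.
    near=> x; rewrite ppow_pos//; apply: ltW.
    by near: x; exact: lt_nbhsr.
  rewrite /continuous_at ppow_pos ?ltW//.
  by apply: (cvg_trans (near_eq_cvg E)); exact: powR_continuous.
rewrite /continuous_at ppow_neg ?gt_eqF//.
apply/cvgrPdist_lt => e e0; near=> x.
rewrite sub0r normrN ger0_norm ?ppow_ge0//.
have [x0|x0] := leP x 0; first by rewrite ppow_neg// gt_eqF.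
rewrite ppow_pos ?ltW//.
(* Writing e as a q-th power turns the claim into x < e^(1/q), which holds near 0. *)
have -> : e = (e `^ q^-1) `^ q by rewrite -powRrM mulVf ?powRr1 ?gt_eqF// ltW.
rewrite gt0_ltr_powR ?nnegrE ?powR_ge0 ?ltW//.
by near: x; exact: (lt_nbhsl (powR_gt0 _ e0)).
Unshelve. all: by end_near. Qed.

Lemma is_derive_ppow (R : realType) (q s : R) :
  1 < q -> is_derive s 1 (ppow q) (q * ppow (q - 1) s).
Proof.
move=> q1; have q0 : 0 < q by lra.
have q10 : 0 < q - 1 by lra.
case: (ltgtP s 0) => [s0|s0|->].
- rewrite ppow_neg ?gt_eqF// 1?ltW// mulr0.
  apply: (@near_eq_is_derive _ _ _ (cst 0)) => //.
  near=> x; rewrite ppow_neg// ?gt_eqF//; apply: ltW.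
  by near: x; exact: lt_nbhsl.
- rewrite ppow_pos ?ltW//.
  apply: (@near_eq_is_derive _ _ _ (fun x => x `^ q)) => //.
    near=> x; rewrite ppow_pos//; apply: ltW.
    by near: x; exact: lt_nbhsr.
  exact: is_derive1_powR.
rewrite ppow_neg ?gt_eqF// mulr0.
(* At the corner 0 the power factors as s_+^(q-1) times s, a continuous function vanishing at 0
   times a differentiable one vanishing at 0. *)
have -> : ppow q = (fun y => ppow (q - 1) y * y).
  apply/funext => y; have [y0|y0] := leP y 0.
    by rewrite !ppow_neg ?gt_eqF// mul0r.
  by rewrite !ppow_pos ?ltW// mulrC mulr_powRB1// ltW.
apply: (@is_derive_mul_zero _ _ _ id _ _ 1) => //.
  exact: ppow_continuous.
by rewrite ppow_neg// gt_eqF.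
Unshelve. all: by end_near. Qed.

(** * Coordinates and the squared norm *)

Lemma coord_quot (R : realType) (m : nat) (i j : 'I_m) (h : R) (x : 'rV[R]_m) :
  (h *: unitv R i + x) ord0 j = (i == j)%:R * h + x ord0 j.
Proof. by rewrite !mxE eqxx eq_sym mulrC. Qed.

Lemma is_derive_coord (R : realType) (m : nat) (i : 'I_m) (x : 'rV[R]_m) :
  is_derive x (unitv R i) (fun y : 'rV[R]_m => y ord0 i) 1.
Proof.
apply: (@is_derive_cvg _ _ _ _ _ (fun=> 1)); first exact: cvg_cst.
by move=> h h0; rewrite coord_quot eqxx mul1r addrK mulVf.
Qed.

Lemma is_derive_normsq (R : realType) (m : nat) (i : 'I_m) (x : 'rV[R]_m) :
  is_derive x (unitv R i) (@normsq R m) (2 * x ord0 i).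
Proof.
apply: (@is_derive_cvg _ _ _ _ _ (fun h => h + 2 * x ord0 i)).
  rewrite -[X in _ --> X]add0r.
  apply: (cvg_trans _ (@continuous_add _ _ (fun h : R => h) (fun=> 2 * x ord0 i) (0 : R) _ _)).
  - by apply: cvg_app; exact: nbhs_dnbhs.
  - exact: cvg_id.
  - exact: cvg_cst.
move=> h h0; rewrite /normsq -sumrB (bigD1 i) //= big1 => [|j ji].
  by rewrite coord_quot eqxx mul1r; field.
by rewrite coord_quot eq_sym (negbTE ji) mul0r add0r subrr.
Qed.

Lemma coord_cont (R : realType) (m : nat) (i : 'I_m) :
  continuous (fun y : 'rV[R]_m => y ord0 i).
Proof. exact: coord_continuous. Qed.

Lemma normsq_continuous (R : realType) (m : nat) : continuous (@normsq R m).
Proof.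
move=> x; apply: continuous_bigsum => i.
rewrite (_ : (fun _ => _) = (fun y : 'rV[R]_m => y ord0 i * y ord0 i)).
  by apply: continuous_mul; exact: coord_cont.
by apply/funext => y; rewrite expr2.
Qed.

Lemma eball_open (R : realType) (m : nat) : open (@eball R m).
Proof.
rewrite openE => x xb; have := @normsq_continuous R m x.
by move=> /cvgr_lt /(_ _ xb).
Qed.

(** * Green's identity against a radial weight *)

(* Mixed second derivatives play no role, only the pure ones enter lap. *)
Definition C2_axis (R : realType) (m : nat) (F : 'rV[R]_m -> R) : Prop :=
  forall x, eball x -> {for x, continuous F} /\
    forall i, [/\ derivable F x (unitv R i), {for x, continuous (partial i F)},
      derivable (partial i F) x (unitv R i) &
      {for x, continuous (partial i (partial i F))}].

Definition rho (R : realType) (m : nat) (b r : R) (x : 'rV[R]_m) : R :=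
  ppow b (r - normsq x).

Definition drho (R : realType) (m : nat) (b r : R) (i : 'I_m) (x : 'rV[R]_m) : R :=
  (b * ppow (b - 1) (r - normsq x)) * (- (2 * x ord0 i)).

(** The second derivative of [rho] along axis i in closed form. For b > 2 the exponents b - 1 and b
    - 2 are positive, so it is continuous across the sphere |x|^2 = r. *)
Definition ddrho (R : realType) (m : nat) (b r : R) (i : 'I_m) (x : 'rV[R]_m) : R :=
  4 * b * (b - 1) * x ord0 i ^+ 2 * ppow (b - 2) (r - normsq x)
  - 2 * b * ppow (b - 1) (r - normsq x).

Lemma ppow_rho_continuous (R : realType) (m : nat) (q r : R) :
  0 < q -> continuous (fun x : 'rV[R]_m => ppow q (r - normsq x)).
Proof.
move=> q0 x; apply: (@continuous_comp _ _ _ (fun x => r - normsq x) (ppow q));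
  last exact: ppow_continuous.
by apply: continuous_sub; [exact: continuous_const|exact: normsq_continuous].
Qed.

Lemma ppow_rho_is_derive (R : realType) (m : nat) (q r : R) (i : 'I_m) (x : 'rV[R]_m) :
  1 < q -> is_derive x (unitv R i) (fun x : 'rV[R]_m => ppow q (r - normsq x))
    ((q * ppow (q - 1) (r - normsq x)) * (- (2 * x ord0 i))).
Proof.
move=> q1; apply: (@is_derive_chain _ _ (fun x => r - normsq x)).
  have dn := is_derive_normsq i x.
  by rewrite -[X in is_derive _ _ _ X]add0r; exact: (is_deriveB (is_derive_cst r x _) dn).
exact: is_derive_ppow.
Qed.

Lemma rho_is_derive (R : realType) (m : nat) (b r : R) (i : 'I_m) (x : 'rV[R]_m) :
  2 < b -> is_derive x (unitv R i) (rho b r) (drho b r i x).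
Proof. by move=> b2; apply: ppow_rho_is_derive; lra. Qed.

Lemma drho_is_derive (R : realType) (m : nat) (b r : R) (i : 'I_m) (x : 'rV[R]_m) :
  2 < b -> is_derive x (unitv R i) (drho b r i) (ddrho b r i x).
Proof.
move=> b2.
have b1 : 1 < b - 1 by lra.
have h1 := ppow_rho_is_derive r i x b1.
have h2 := is_derive_coord i x.
have h := is_deriveM (is_deriveZ (b * (- 2)) h1) h2.
rewrite (_ : drho b r i =
  ((b * -2) \*: (fun x : 'rV[R]_m => ppow (b - 1) (r - normsq x))) *
    (fun y : 'rV[R]_m => y ord0 i)).
  apply: (is_derive_eq h); rewrite /ddrho /= /GRing.scale /=.
  rewrite (_ : b - 1 - 1 = b - 2); last lra.
  ring.
apply/funext => y.
rewrite [RHS](_ : _ = b * -2 * ppow (b - 1) (r - normsq y) * y ord0 i)// /drho.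
by ring.
Qed.

Lemma rho_continuous (R : realType) (m : nat) (b r : R) :
  2 < b -> continuous (@rho R m b r).
Proof. by move=> b2; apply: ppow_rho_continuous; lra. Qed.

Lemma drho_continuous (R : realType) (m : nat) (b r : R) (i : 'I_m) :
  2 < b -> continuous (@drho R m b r i).
Proof.
move=> b2 x; rewrite /drho; apply: (@continuous_mul R 'rV[R]_m).
  by apply: continuous_mul; [exact: continuous_const|apply: ppow_rho_continuous; lra].
apply: continuous_opp.
by apply: continuous_mul; [exact: continuous_const|exact: coord_cont].
Qed.

Lemma ddrho_continuous (R : realType) (m : nat) (b r : R) (i : 'I_m) :
  2 < b -> continuous (@ddrho R m b r i).
Proof.
move=> b2 x; rewrite /ddrho; apply: (@continuous_sub R 'rV[R]_m); last first.
  by apply: continuous_mul; [exact: continuous_const|apply: ppow_rho_continuous; lra].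
apply: continuous_mul; last by apply: ppow_rho_continuous; lra.
apply: continuous_mul; first exact: continuous_const.
rewrite (_ : (fun _ => _) = (fun y : 'rV[R]_m => y ord0 i * y ord0 i)).
  by apply: continuous_mul; exact: coord_cont.
by apply/funext => y; rewrite expr2.
Qed.

Lemma ppow_rho_supp (R : realType) (m : nat) (q r : R) (x : 'rV[R]_m) :
  0 < q -> r <= normsq x -> ppow q (r - normsq x) = 0.
Proof. by move=> q0 h; rewrite ppow_neg ?gt_eqF// subr_le0. Qed.

Lemma rho_supp (R : realType) (m : nat) (b r : R) (x : 'rV[R]_m) :
  2 < b -> r <= normsq x -> rho b r x = 0.
Proof. by move=> b2 h; rewrite /rho ppow_rho_supp//; lra. Qed.

Lemma drho_supp (R : realType) (m : nat) (b r : R) (i : 'I_m) (x : 'rV[R]_m) :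
  2 < b -> r <= normsq x -> drho b r i x = 0.
Proof. by move=> b2 h; rewrite /drho ppow_rho_supp ?mulr0 ?mul0r//; lra. Qed.

Lemma ddrho_supp (R : realType) (m : nat) (b r : R) (i : 'I_m) (x : 'rV[R]_m) :
  2 < b -> r <= normsq x -> ddrho b r i x = 0.
Proof.
move=> b2 h; rewrite /ddrho !ppow_rho_supp//; [|lra|lra].
by rewrite !mulr0 subrr.
Qed.

Lemma normsq_ge_coord (R : realType) (m : nat) (x : 'rV[R]_m) (i : 'I_m) :
  x ord0 i ^+ 2 <= normsq x.
Proof.
by rewrite /normsq (bigD1 i) //= lerDl sumr_ge0// => j _; exact: sqr_ge0.
Qed.

Lemma normsq_gt1 (R : realType) (m : nat) (x : 'rV[R]_m) (i : 'I_m) :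
  1 < `|x ord0 i| -> 1 < normsq x.
Proof.
move=> h; apply: lt_le_trans (normsq_ge_coord x i).
by rewrite -real_normK ?num_real// expr_gt1.
Qed.

(** Outside the ball |x|^2 >= 1 > r, so the cutoff a vanishes in a whole neighbourhood. The product
    is thus locally zero there, whatever the values of g, which is controlled only inside the
    ball. *)
Lemma near_supp (R : realType) (m : nat) (a g : 'rV[R]_m -> R) (r : R) (x : 'rV[R]_m) :
  (forall x, r <= normsq x -> a x = 0) -> r < 1 -> ~ eball x ->
  \forall y \near x, cst 0 y = a y * g y.
Proof.
move=> a0 r1 /negP; rewrite -leNgt => x1.
have rx : r < normsq x by exact: lt_le_trans x1.
have /cvgr_gt /(_ _ rx) := @normsq_continuous R m x.
by apply: filterS => y /ltW ry; rewrite a0// mul0r.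
Qed.

Lemma cutoff_continuous (R : realType) (m : nat) (a g : 'rV[R]_m -> R) (r : R) :
  continuous a -> (forall x, r <= normsq x -> a x = 0) -> r < 1 ->
  (forall x, eball x -> {for x, continuous g}) ->
  continuous (fun x => a x * g x).
Proof.
move=> ca a0 r1 cg x; have [xb|xb] := pselect (eball x).
  by apply: continuous_mul; [exact: ca|exact: cg].
have E := near_supp g a0 r1 xb.
rewrite /continuous_at -(nbhs_singleton E).
by apply: (cvg_trans (near_eq_cvg E)); exact: cvg_cst.
Qed.

Lemma cutoff_is_derive (R : realType) (m : nat) (a g : 'rV[R]_m -> R) (r da dg : R)
    (i : 'I_m) (x : 'rV[R]_m) :
  (forall x, r <= normsq x -> a x = 0) -> r < 1 ->
  (eball x -> is_derive x (unitv R i) a da) ->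
  (eball x -> is_derive x (unitv R i) g dg) ->
  (~ eball x -> da = 0 /\ a x = 0) ->
  is_derive x (unitv R i) (fun x => a x * g x) (a x * dg + g x * da).
Proof.
move=> a0 r1 dA dG d0; have [xb|xb] := pselect (eball x).
  exact: (is_deriveM (dA xb) (dG xb)).
have [-> ->] := d0 xb; rewrite mul0r mulr0 addr0.
exact: (near_eq_is_derive (near_supp g a0 r1 xb)).
Qed.

Lemma green_axis (R : realType) (m : nat) (mu : {measure set (m.-tuple R) -> \bar R})
    (F : 'rV[R]_m -> R) (b r : R) (i : 'I_m) :
  is_dVN mu -> C2_axis F -> 2 < b -> r < 1 ->
  (\int[mu]_t (rho b r (rv_of_tuple t) * partial i (partial i F) (rv_of_tuple t)
    - ddrho b r i (rv_of_tuple t) * F (rv_of_tuple t))%:E = 0)%E.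
Proof.
move=> dmu hF b2 r1.
have r0 := fun x => @rho_supp R m b r x b2.
have d0 := fun x => @drho_supp R m b r i x b2.
have dd0 := fun x => @ddrho_supp R m b r i x b2.
have cF x : eball x -> {for x, continuous F} by move=> /hF[].
have cF1 x : eball x -> {for x, continuous (partial i F)}.
  by move=> /hF[_ /(_ i)[]].
have cF2 x : eball x -> {for x, continuous (partial i (partial i F))}.
  by move=> /hF[_ /(_ i)[]].
have out (x : 'rV[R]_m) : ~ eball x -> r <= normsq x.
  by move=> /negP; rewrite -leNgt; apply: le_trans; exact: ltW.
have K1 (x : 'rV[R]_m) j : 1 < `|x ord0 j| -> r <= normsq x.
  by move=> /normsq_gt1 h; exact: (le_trans (ltW r1) (ltW h)).
(* In the derivative of rho d_i F - F d_i rho the two mixed products cancel, leaving the integrand.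
   The support cube has K = 1, since a coordinate larger than 1 in absolute value forces |x|^2 > 1 >
   r. *)
apply: (@integral_partial_eq0 _ _ _ (fun x => rho b r x * partial i F x - drho b r i x * F x)
   (fun x => rho b r x * partial i (partial i F) x - ddrho b r i x * F x) i 1 dmu).
- move=> x; apply: (@continuous_sub R 'rV[R]_m).
    exact: (cutoff_continuous (rho_continuous b2) r0 r1 cF1).
  exact: (cutoff_continuous (drho_continuous b2) d0 r1 cF).
- move=> x; apply: (@continuous_sub R 'rV[R]_m).
    exact: (cutoff_continuous (rho_continuous b2) r0 r1 cF2).
  exact: (cutoff_continuous (ddrho_continuous b2) dd0 r1 cF).
- move=> x.
  have h1 : is_derive x (unitv R i) (fun x => rho b r x * partial i F x)
      (rho b r x * partial i (partial i F) x + partial i F x * drho b r i x).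
    apply: (cutoff_is_derive r0 r1) => [_|/hF[_ /(_ i)[_ _ h _]]|/out h].
    - exact: rho_is_derive.
    - exact: derivableP.
    - by rewrite d0 ?r0.
  have h2 : is_derive x (unitv R i) (fun x => drho b r i x * F x)
      (drho b r i x * partial i F x + F x * ddrho b r i x).
    apply: (cutoff_is_derive d0 r1) => [_|/hF[_ /(_ i)[h _ _ _]]|/out h].
    - exact: drho_is_derive.
    - exact: derivableP.
    - by rewrite dd0 ?d0.
  apply: (is_derive_eq (is_deriveB h1 h2)); ring.
- by move=> x j /K1 h; rewrite r0// d0// !mul0r subrr.
- by move=> x j /K1 h; rewrite r0// dd0// !mul0r subrr.
Qed.

Definition wgt (R : realType) (m : nat) (b r : R) (x : 'rV[R]_m) : R :=
  4 * b * (b - 1) * normsq x * ppow (b - 2) (r - normsq x)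
  - 2 * m%:R * b * ppow (b - 1) (r - normsq x).

Lemma wgtE (R : realType) (m : nat) (b r : R) (x : 'rV[R]_m) :
  wgt b r x = \sum_(i < m) ddrho b r i x.
Proof.
rewrite /ddrho sumrB -mulr_suml -mulr_sumr sumr_const card_ord /wgt -/(normsq x).
by congr (_ - _); rewrite -mulr_natl; ring.
Qed.

Lemma green (R : realType) (m : nat) (mu : {measure set (m.-tuple R) -> \bar R})
    (F : 'rV[R]_m -> R) (b r : R) :
  is_dVN mu -> C2_axis F -> 2 < b -> r < 1 ->
  (\int[mu]_t (rho b r (rv_of_tuple t) * lap F (rv_of_tuple t))%:E =
   \int[mu]_t (wgt b r (rv_of_tuple t) * F (rv_of_tuple t))%:E)%E.
Proof.
move=> dmu hF b2 r1.
have r0 := fun x => @rho_supp R m b r x b2.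
have dd0 i := fun x => @ddrho_supp R m b r i x b2.
have cF x : eball x -> {for x, continuous F} by move=> /hF[].
have cF2 i x : eball x -> {for x, continuous (partial i (partial i F))}.
  by move=> /hF[_ /(_ i)[]].
have K1 (x : 'rV[R]_m) j : 1 < `|x ord0 j| -> r <= normsq x.
  by move=> /normsq_gt1 h; exact: (le_trans (ltW r1) (ltW h)).
have i1 i : mu.-integrable setT (fun t => (rho b r (rv_of_tuple t) *
    partial i (partial i F) (rv_of_tuple t))%:E).
  apply: (@continuous_supp_integrable _ _ _
    (fun x => rho b r x * partial i (partial i F) x) 1 dmu).
    exact: (cutoff_continuous (rho_continuous b2) r0 r1 (cF2 i)).
  by move=> x j /K1 h; rewrite r0// mul0r.
have i2 i : mu.-integrable setT (fun t => (ddrho b r i (rv_of_tuple t) *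
    F (rv_of_tuple t))%:E).
  apply: (@continuous_supp_integrable _ _ _ (fun x => ddrho b r i x * F x) 1 dmu).
    exact: (cutoff_continuous (ddrho_continuous b2) (dd0 i) r1 cF).
  by move=> x j /K1 h; rewrite dd0// mul0r.
have E i : (\int[mu]_t (rho b r (rv_of_tuple t) *
    partial i (partial i F) (rv_of_tuple t))%:E =
    \int[mu]_t (ddrho b r i (rv_of_tuple t) * F (rv_of_tuple t))%:E)%E.
  (* Both terms have compact support and finite integrals, so the vanishing integral of the
     difference splits into an equality. *)
  have := green_axis i dmu hF b2 r1.
  under eq_integral do rewrite EFinB.
  rewrite (integralB_EFin measurableT (i1 i) (i2 i)) => /eqP; rewrite sube_eq ?add0e => [/eqP//||].
    exact: integrable_fin_num.
  by rewrite fin_num_adde_defr//; exact: integrable_fin_num.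
under eq_integral do rewrite /lap mulr_sumr -sumEFin.
under [RHS]eq_integral do rewrite wgtE mulr_suml -sumEFin.
rewrite !integral_sum//.
by apply: eq_bigr => i _; exact: E.
Qed.

(** * The function |f|^p *)

(** Formulas for the derivatives are known only inside the ball. As the ball is open, [partial i F]
    agrees with [G i] near each of its points, which is enough to differentiate once more and to
    transfer continuity. *)
Lemma C2_axis_intro (R : realType) (m : nat) (F : 'rV[R]_m -> R)
    (G L : 'I_m -> 'rV[R]_m -> R) :
  (forall x, eball x -> {for x, continuous F}) ->
  (forall i x, eball x -> is_derive x (unitv R i) F (G i x)) ->
  (forall i x, eball x -> {for x, continuous (G i)}) ->
  (forall i x, eball x -> is_derive x (unitv R i) (G i) (L i x)) ->
  (forall i x, eball x -> {for x, continuous (L i)}) ->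
  C2_axis F /\ forall x, eball x -> lap F x = \sum_(i < m) L i x.
Proof.
move=> cF dF cG dG cL.
have nb x : eball x -> \forall y \near x, eball y.
  by move=> xb; apply: open_nbhs_nbhs; split => //; exact: eball_open.
have EG i x : eball x -> partial i F x = G i x by move=> /(dF i)[_].
have nG i x : eball x -> \forall y \near x, G i y = partial i F y.
  by move=> /nb; apply: filterS => y yb; rewrite EG.
have dPF i x : eball x -> is_derive x (unitv R i) (partial i F) (L i x).
  by move=> xb; exact: near_eq_is_derive (nG i x xb) (dG i x xb).
have EL i x : eball x -> partial i (partial i F) x = L i x by move=> /(dPF i)[_].
have nL i x : eball x -> \forall y \near x, L i y = partial i (partial i F) y.
  by move=> /nb; apply: filterS => y yb; rewrite EL.
split; last by move=> x xb; apply: eq_bigr => i _; exact: EL.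
move=> x xb; split; first exact: cF.
move=> i; split.
- by have [] := dF i x xb.
- exact: (near_eq_continuous (nG i x xb) (cG i x xb)).
- by have [] := dPF i x xb.
- exact: (near_eq_continuous (nL i x xb) (cL i x xb)).
Qed.

Lemma continuous_squeeze0 (R : realType) (T : topologicalType) (f N : T -> R) (x : T) :
  (forall y, `|f y| <= N y) -> {for x, continuous N} -> N x = 0 ->
  {for x, continuous f}.
Proof.
move=> fN cN N0.
have f0 : f x = 0 by apply/eqP; rewrite -normr_le0 -N0.
rewrite /prop_for /continuous_at f0; apply/cvgrPdist_lt => e e0.
have Ne : N x < e by rewrite N0.
have /cvgr_lt /(_ _ Ne) := cN; apply: filterS => y.
by rewrite sub0r normrN; exact: le_lt_trans.
Qed.

Lemma is_derive_ppow_pos (R : realType) (q s : R) :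
  0 < s -> is_derive s 1 (ppow q) (q * s `^ (q - 1)).
Proof.
move=> s0; apply: (@near_eq_is_derive _ _ _ (fun x => x `^ q)) => //.
  near=> x; rewrite ppow_pos//; apply: ltW.
  by near: x; exact: lt_nbhsr.
exact: is_derive1_powR.
Unshelve. all: by end_near. Qed.

(** * Derivatives of |f|^2 *)

Definition sq2 (R : realType) (m : nat) (u v : 'rV[R]_m -> R) (x : 'rV[R]_m) : R :=
  u x ^+ 2 + v x ^+ 2.

Definition dsq2 (R : realType) (m : nat) (u v : 'rV[R]_m -> R) (i : 'I_m)
    (x : 'rV[R]_m) : R :=
  2 * (u x * partial i u x + v x * partial i v x).

Definition ddsq2 (R : realType) (m : nat) (u v : 'rV[R]_m -> R) (i : 'I_m)
    (x : 'rV[R]_m) : R :=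
  2 * (partial i u x ^+ 2 + u x * partial i (partial i u) x +
       (partial i v x ^+ 2 + v x * partial i (partial i v) x)).

(** Viewing |f|^p as the power p/2 of the twice differentiable |f|^2 avoids differentiating the
    square root at the zeros of f. *)
Lemma cabs_powE (R : realType) (m : nat) (u v : 'rV[R]_m -> R) (p : R) :
  (fun x => cabs u v x `^ p) = (fun x => ppow (p / 2) (sq2 u v x)).
Proof.
apply/funext => x.
have s0 : 0 <= u x ^+ 2 + v x ^+ 2 by rewrite addr_ge0 ?sqr_ge0.
by rewrite ppow_pos// mulrC powRrM powR12_sqrt.
Qed.

Lemma C2_on_axis (R : realType) (m : nat) (u : 'rV[R]_m -> R) :
  C2_on (@eball R m) u -> C2_axis u.
Proof.
move=> hu x xb; have [cu du d2u] := hu x xb.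
by split => // i; have [d1 c1] := du i; have [d2 c2] := d2u i i.
Qed.

Lemma sq2_is_derive (R : realType) (m : nat) (u v : 'rV[R]_m -> R) (i : 'I_m)
    (x : 'rV[R]_m) : C2_axis u -> C2_axis v -> eball x ->
  is_derive x (unitv R i) (sq2 u v) (dsq2 u v i x).
Proof.
move=> hu hv xb.
have [_ /(_ i)[/derivableP du _ _ _]] := hu x xb.
have [_ /(_ i)[/derivableP dv _ _ _]] := hv x xb.
have h := is_deriveD (is_deriveM du du) (is_deriveM dv dv).
rewrite (_ : sq2 u v = u * u + v * v).
  apply: (is_derive_eq h); rewrite /dsq2 -/(partial i u x) -/(partial i v x).
  rewrite /GRing.scale /=; ring.
by apply/funext => y; rewrite /sq2 !expr2.
Qed.

Lemma dsq2_is_derive (R : realType) (m : nat) (u v : 'rV[R]_m -> R) (i : 'I_m)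
    (x : 'rV[R]_m) : C2_axis u -> C2_axis v -> eball x ->
  is_derive x (unitv R i) (dsq2 u v i) (ddsq2 u v i x).
Proof.
move=> hu hv xb.
have [_ /(_ i)[/derivableP du _ /derivableP d2u _]] := hu x xb.
have [_ /(_ i)[/derivableP dv _ /derivableP d2v _]] := hv x xb.
have h := is_deriveZ 2 (is_deriveD (is_deriveM du d2u) (is_deriveM dv d2v)).
rewrite (_ : dsq2 u v i = 2 \*: (u * partial i u + v * partial i v)).
  apply: (is_derive_eq h); rewrite /ddsq2 -/(partial i u x) -/(partial i v x).
  rewrite -/(partial i (partial i u) x) -/(partial i (partial i v) x).
  rewrite /GRing.scale /=.
  move: (partial i (partial i u) x) (partial i (partial i v) x) => a b.
  by move: (partial i u x) (partial i v x) => c d; ring.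
by apply/funext => y.
Qed.

Lemma sq2_continuous (R : realType) (m : nat) (u v : 'rV[R]_m -> R) (x : 'rV[R]_m) :
  C2_axis u -> C2_axis v -> eball x -> {for x, continuous (sq2 u v)}.
Proof.
move=> hu hv xb; have [cu _] := hu x xb; have [cv _] := hv x xb.
rewrite (_ : sq2 u v = (fun y => u y * u y + v y * v y)).
  by apply: continuous_add; exact: continuous_mul.
by apply/funext => y; rewrite /sq2 !expr2.
Qed.

Lemma dsq2_continuous (R : realType) (m : nat) (u v : 'rV[R]_m -> R) (i : 'I_m)
    (x : 'rV[R]_m) :
  C2_axis u -> C2_axis v -> eball x -> {for x, continuous (dsq2 u v i)}.
Proof.
move=> hu hv xb; have [cu /(_ i)[_ cu1 _ _]] := hu x xb.
have [cv /(_ i)[_ cv1 _ _]] := hv x xb.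
apply: (@continuous_mul R 'rV[R]_m); first exact: continuous_const.
by apply: continuous_add; [exact: (continuous_mul cu cu1)|exact: (continuous_mul cv cv1)].
Qed.

Lemma grad_sq_continuous (R : realType) (m : nat) (u v : 'rV[R]_m -> R) (i : 'I_m)
    (x : 'rV[R]_m) : C2_axis u -> C2_axis v -> eball x ->
  {for x, continuous (fun y => partial i u y ^+ 2 + partial i v y ^+ 2)}.
Proof.
move=> hu hv xb; have [_ /(_ i)[_ cu1 _ _]] := hu x xb.
have [_ /(_ i)[_ cv1 _ _]] := hv x xb.
rewrite (_ : (fun _ => _) = (fun y => partial i u y * partial i u y +
  partial i v y * partial i v y)).
  by apply: continuous_add; [exact: (continuous_mul cu1 cu1)|exact: (continuous_mul cv1 cv1)].
by apply/funext => y; rewrite !expr2.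
Qed.

Lemma ddsq2_continuous (R : realType) (m : nat) (u v : 'rV[R]_m -> R) (i : 'I_m)
    (x : 'rV[R]_m) :
  C2_axis u -> C2_axis v -> eball x -> {for x, continuous (ddsq2 u v i)}.
Proof.
move=> hu hv xb; have [cu /(_ i)[_ cu1 _ cu2]] := hu x xb.
have [cv /(_ i)[_ cv1 _ cv2]] := hv x xb.
rewrite (_ : ddsq2 u v i = (fun y => 2 * ((partial i u y ^+ 2 + partial i v y ^+ 2) +
   (u y * partial i (partial i u) y + v y * partial i (partial i v) y)))).
  apply: continuous_mul; first exact: continuous_const.
  apply: continuous_add; first exact: grad_sq_continuous.
  apply: continuous_add; [exact: (continuous_mul cu cu2)|exact: (continuous_mul cv cv2)].
apply/funext => y; rewrite /ddsq2.
move: (partial i (partial i u) y) (partial i (partial i v) y) => a b.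
by move: (partial i u y) (partial i v y) => c d; ring.
Qed.

Lemma sq2_eq0 (R : realType) (m : nat) (u v : 'rV[R]_m -> R) (x : 'rV[R]_m) :
  sq2 u v x = 0 -> u x = 0 /\ v x = 0.
Proof.
move=> /eqP; rewrite paddr_eq0 ?sqr_ge0// !sqrf_eq0 => /andP[/eqP-> /eqP->].
by [].
Qed.

Lemma sq2_ge0 (R : realType) (m : nat) (u v : 'rV[R]_m -> R) (x : 'rV[R]_m) :
  0 <= sq2 u v x.
Proof. by rewrite addr_ge0 ?sqr_ge0. Qed.

(* Cauchy-Schwarz; it shows that the singular factor s^(q-2) (d_i s)^2 of the
   second derivative is O(s^(q-1)). *)
Lemma dsq2_sq_le (R : realType) (m : nat) (u v : 'rV[R]_m -> R) (i : 'I_m)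
    (x : 'rV[R]_m) :
  dsq2 u v i x ^+ 2 <= 4 * sq2 u v x * (partial i u x ^+ 2 + partial i v x ^+ 2).
Proof.
rewrite /dsq2 /sq2 -subr_ge0.
rewrite [X in 0 <= X](_ : _ = (2 * (u x * partial i v x - v x * partial i u x)) ^+ 2).
  exact: sqr_ge0.
by move: (partial i u x) (partial i v x) => a b; ring.
Qed.

(** Where f is nonzero, this is [dsq2_sq_le] multiplied by s^(q-2), with s = |f|^2. At a zero of f,
    [dsq2] vanishes, so the left side is 0 whatever value the power takes there. *)
Lemma powR_sq2_dsq2_le (R : realType) (m : nat) (u v : 'rV[R]_m -> R) (i : 'I_m)
    (x : 'rV[R]_m) (q : R) :
  sq2 u v x `^ (q - 2) * dsq2 u v i x ^+ 2 <=
  4 * ppow (q - 1) (sq2 u v x) * (partial i u x ^+ 2 + partial i v x ^+ 2).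
Proof.
have g0 : 0 <= partial i u x ^+ 2 + partial i v x ^+ 2 by rewrite addr_ge0 ?sqr_ge0.
have := sq2_ge0 u v x; rewrite le_eqVlt => /orP[/eqP/esym s0|s0].
  have [u0 v0] := sq2_eq0 s0.
  rewrite /dsq2 u0 v0 !mul0r addr0 mulr0 expr2 !mulr0.
  by rewrite mulr_ge0 ?mulr_ge0 ?ppow_ge0 ?powR_ge0.
rewrite (le_trans (ler_wpM2l (powR_ge0 _ _) (dsq2_sq_le u v i x)))//.
rewrite ppow_pos ?sq2_ge0// (_ : q - 1 = (q - 2) + 1); last by ring.
rewrite (@powRD _ _ (q - 2) 1); last by apply/implyP => _; rewrite gt_eqF.
rewrite powRr1 ?(ltW s0)// le_eqVlt; apply/orP; left; apply/eqP.
move: (sq2 u v x `^ (q - 2)) => a; move: (sq2 u v x) => b.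
by move: (partial i u x ^+ 2 + partial i v x ^+ 2) => c; ring.
Qed.

Definition dpow (R : realType) (m : nat) (u v : 'rV[R]_m -> R) (q : R) (i : 'I_m)
    (x : 'rV[R]_m) : R :=
  q * ppow (q - 1) (sq2 u v x) * dsq2 u v i x.

(** The second axis derivative of s^q for s = |f|^2. The exponent q - 2 may be negative; at the
    zeros of f the factor [dsq2] makes that term 0. *)
Definition ddpow (R : realType) (m : nat) (u v : 'rV[R]_m -> R) (q : R) (i : 'I_m)
    (x : 'rV[R]_m) : R :=
  q * (q - 1) * (sq2 u v x `^ (q - 2) * dsq2 u v i x ^+ 2) +
  q * ppow (q - 1) (sq2 u v x) * ddsq2 u v i x.

Lemma ppow_sq2_continuous (R : realType) (m : nat) (u v : 'rV[R]_m -> R) (q : R)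
    (x : 'rV[R]_m) : 0 < q ->
  C2_axis u -> C2_axis v -> eball x ->
  {for x, continuous (fun x => ppow q (sq2 u v x))}.
Proof.
move=> q0 hu hv xb.
apply: (@continuous_comp _ _ _ (sq2 u v) (ppow q)); last exact: ppow_continuous.
exact: sq2_continuous.
Qed.

Lemma dpow_is_derive (R : realType) (m : nat) (u v : 'rV[R]_m -> R) (q : R) (i : 'I_m)
    (x : 'rV[R]_m) : 1 < q ->
  C2_axis u -> C2_axis v -> eball x ->
  is_derive x (unitv R i) (dpow u v q i) (ddpow u v q i x).
Proof.
move=> q1 hu hv xb.
have dd := @dsq2_is_derive _ _ _ _ i _ hu hv xb.
have q10 : 0 < q - 1 by lra.
have := sq2_ge0 u v x; rewrite le_eqVlt => /orP[/eqP/esym s0|s0].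
  have [u0 v0] := sq2_eq0 s0.
  have d0 : dsq2 u v i x = 0 by rewrite /dsq2 u0 v0 !mul0r addr0 mulr0.
  have p0 : ppow (q - 1) (sq2 u v x) = 0 by rewrite s0 ppow_neg ?gt_eqF.
  rewrite /ddpow d0 p0 expr2 !mulr0 mul0r addr0.
  (* At a zero of f the coefficient q s^(q-1) is continuous and vanishes together with [dsq2], so
     the derivative is 0, as is [ddpow]. *)
  apply: (is_derive_mul_zero _ _ dd d0); last by rewrite p0 mulr0.
  apply: continuous_mul; first exact: continuous_const.
  exact: ppow_sq2_continuous.
have h1 := is_derive_chain (sq2_is_derive i hu hv xb) (is_derive_ppow_pos (q - 1) s0).
have h := is_deriveM (is_deriveZ q h1) dd.
rewrite (_ : dpow u v q i = (q \*: (fun x => ppow (q - 1) (sq2 u v x))) * dsq2 u v i)//.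
apply: (is_derive_eq h); rewrite /ddpow.
rewrite [LHS](_ : _ = q * ppow (q - 1) (sq2 u v x) * ddsq2 u v i x +
  dsq2 u v i x * (q * ((q - 1) * sq2 u v x `^ (q - 1 - 1) * dsq2 u v i x)))//.
by rewrite (_ : q - 1 - 1 = q - 2); [ring|ring].
Qed.

Lemma ddpow_continuous (R : realType) (m : nat) (u v : 'rV[R]_m -> R) (q : R) (i : 'I_m)
    (x : 'rV[R]_m) : 1 < q ->
  C2_axis u -> C2_axis v -> eball x -> {for x, continuous (ddpow u v q i)}.
Proof.
move=> q1 hu hv xb; have q10 : 0 < q - 1 by lra.
apply: (@continuous_add R 'rV[R]_m); last first.
  apply: continuous_mul; last exact: ddsq2_continuous.
  apply: continuous_mul; first exact: continuous_const.
  exact: ppow_sq2_continuous.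
apply: continuous_mul; first exact: continuous_const.
have := sq2_ge0 u v x; rewrite le_eqVlt => /orP[/eqP/esym s0|s0].
  (* At a zero of f the singular term is squeezed by a multiple of s^(q-1), continuous and zero
     there because q > 1. *)
  apply: (continuous_squeeze0 (N := fun y => 4 * ppow (q - 1) (sq2 u v y) *
      (partial i u y ^+ 2 + partial i v y ^+ 2))).
  - move=> y; rewrite ger0_norm; first exact: powR_sq2_dsq2_le.
    by rewrite mulr_ge0 ?powR_ge0 ?sqr_ge0.
  - apply: continuous_mul; last exact: grad_sq_continuous.
    apply: continuous_mul; first exact: continuous_const.
    exact: ppow_sq2_continuous.
  - by rewrite s0 ppow_neg ?gt_eqF// mulr0 mul0r.
apply: continuous_mul.
  apply: (@continuous_comp _ _ _ (sq2 u v) (fun s => s `^ (q - 2))).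
    exact: sq2_continuous.
  exact: powR_continuous.
rewrite (_ : (fun _ => _) = (fun y => dsq2 u v i y * dsq2 u v i y)).
  by apply: continuous_mul; exact: dsq2_continuous.
by apply/funext => y; rewrite expr2.
Qed.

(** The sum is twice |grad u|^2 + |grad v|^2 + u lap u + v lap v, and the last two terms form Re(f
    conj(lap f)). *)
Lemma sum_ddsq2_ge0 (R : realType) (m : nat) (u v : 'rV[R]_m -> R) (x : 'rV[R]_m) :
  0 <= u x * lap u x + v x * lap v x -> 0 <= \sum_(i < m) ddsq2 u v i x.
Proof.
have aux (a b c d : 'I_m -> R) (U V : R) :
    0 <= U * (\sum_i b i) + V * (\sum_i d i) ->
    0 <= \sum_i 2 * (a i ^+ 2 + U * b i + (c i ^+ 2 + V * d i)).
  move=> h; rewrite -mulr_sumr mulr_ge0// !big_split /= -!mulr_sumr.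
  have a1 : 0 <= \sum_i a i ^+ 2 by apply: sumr_ge0 => i _; exact: sqr_ge0.
  have a2 : 0 <= \sum_i c i ^+ 2 by apply: sumr_ge0 => i _; exact: sqr_ge0.
  lra.
exact: (aux (fun i => partial i u x) (fun i => partial i (partial i u) x)
  (fun i => partial i v x) (fun i => partial i (partial i v) x)).
Qed.

(** With q = p/2 and s = |f|^2, the Laplacian is q(q-1) s^(q-2) |grad s|^2 + q s^(q-1) lap s, and
    both terms are nonnegative because q >= 1. *)
Lemma cabs_pow_C2_axis (R : realType) (m : nat) (u v : 'rV[R]_m -> R) (p : R) :
  2 <= p -> C2_axis u -> C2_axis v ->
  (forall x, eball x -> 0 <= u x * lap u x + v x * lap v x) ->
  C2_axis (fun x => cabs u v x `^ p) /\
  forall x, eball x -> 0 <= lap (fun x => cabs u v x `^ p) x.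
Proof.
move=> p2 hu hv hf; rewrite cabs_powE.
have : 1 <= p / 2 by lra.
move: (p / 2) => q; rewrite le_eqVlt => /orP[/eqP <-|q1].
  (* The case q = 1 is separate: s^(q-1) is then the constant 1 and does not vanish at the zeros of
     f, which the argument for q > 1 relies on. *)
  rewrite (_ : (fun x => ppow 1 (sq2 u v x)) = sq2 u v); last first.
    by apply/funext => x; rewrite ppow_pos ?sq2_ge0// powRr1 ?sq2_ge0.
  have [h1 h2] := C2_axis_intro (fun x => sq2_continuous hu hv)
    (fun i x => @sq2_is_derive _ _ _ _ i x hu hv)
    (fun i x => @dsq2_continuous _ _ _ _ i x hu hv)
    (fun i x => @dsq2_is_derive _ _ _ _ i x hu hv)
    (fun i x => @ddsq2_continuous _ _ _ _ i x hu hv).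
  by split => // x xb; rewrite h2//; apply: sum_ddsq2_ge0; exact: hf.
have q0 : 0 < q by lra.
have q10 : 0 < q - 1 by lra.
have [|||||h1 h2] := @C2_axis_intro _ _ (fun x => ppow q (sq2 u v x))
  (dpow u v q) (ddpow u v q).
- by move=> x; exact: ppow_sq2_continuous.
- move=> i x xb.
  exact: (is_derive_chain (sq2_is_derive i hu hv xb) (is_derive_ppow _ q1)).
- move=> i x xb; apply: (@continuous_mul R 'rV[R]_m); last exact: dsq2_continuous.
  apply: continuous_mul; first exact: continuous_const.
  exact: ppow_sq2_continuous.
- by move=> i x; exact: dpow_is_derive.
- by move=> i x; exact: ddpow_continuous.
have c0 : 0 <= q * (q - 1) by rewrite mulr_ge0// ltW.
split => // x xb; rewrite h2// big_split /= -[X in _ + X]mulr_sumr addr_ge0//.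
  by apply: sumr_ge0 => i _; rewrite mulr_ge0// mulr_ge0 ?powR_ge0 ?sqr_ge0.
apply: mulr_ge0; first by rewrite mulr_ge0 ?ppow_ge0// ltW.
by apply: sum_ddsq2_ge0; exact: hf.
Qed.

(** * The limit r -> 1 *)

(** On [0, 1], lowering the exponent and raising the base both increase a power. This compares a
    weight of radius r and exponent b with its limit, uniformly in r and b. *)
Lemma ppow_le_powR (R : realType) (a b s t : R) :
  0 <= a -> a <= b -> 0 < b -> t <= s -> 0 <= s -> s <= 1 -> ppow b t <= s `^ a.
Proof.
move=> a0 ab b0 ts s0 s1; have [t0|t0] := leP t 0.
  by rewrite ppow_neg ?gt_eqF// powR_ge0.
rewrite ppow_pos; last exact: ltW.
apply: (@le_trans _ _ (t `^ a)).
  by apply: ger_powR => //; rewrite t0 (le_trans ts).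
by apply: ge0_ler_powR => //; rewrite ?nnegrE// ltW.
Qed.

Lemma ppow_le1 (R : realType) (b t : R) : 0 < b -> t <= 1 -> ppow b t <= 1.
Proof.
move=> b0 t1; apply: le_trans (ppow_le_powR (a := 0) (s := 1) _ _ _ _ _ _) _ => //.
  exact: ltW.
by rewrite powRr0.
Qed.

(** Base and exponent vary together; for a positive limit base the power is exp(b ln t), continuous
    in both variables. *)
Lemma ppow_cvg (R : realType) (b_ t_ : nat -> R) (b t : R) : 0 < t ->
  b_ n @[n --> \oo] --> b -> t_ n @[n --> \oo] --> t ->
  ppow (b_ n) (t_ n) @[n --> \oo] --> t `^ b.
Proof.
move=> t0 cb ct.
have E : \forall n \near \oo, expR (b_ n * ln (t_ n)) = ppow (b_ n) (t_ n).
  near=> n; have tn : 0 < t_ n by near: n; exact: (cvgr_gt _ ct).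
  by rewrite ppow_pos ?(ltW tn)// /powR gt_eqF.
apply: (cvg_trans (near_eq_cvg E)); rewrite /powR gt_eqF//.
have c : b_ n * ln (t_ n) @[n --> \oo] --> b * ln t.
  by apply: cvgM => //; exact: (cvg_comp _ _ ct (continuous_ln t0)).
exact: (cvg_comp _ _ c (@continuous_expR _ _)).
Unshelve. all: by end_near. Qed.

(** Fatou's lemma in the form used below: a bound common to all integrals passes to the pointwise
    limit. *)
Lemma fatou_le (d : measure_display) (T : measurableType d) (R : realType)
    (mu : {measure set T -> \bar R}) (D : set T) (f_ : nat -> T -> R) (f : T -> R)
    (C : \bar R) :
  measurable D -> (forall n, measurable_fun D (f_ n)) ->
  (forall n x, D x -> 0 <= f_ n x) ->
  (forall x, D x -> f_ n x @[n --> \oo] --> f x) ->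
  (forall n, (\int[mu]_(x in D) (f_ n x)%:E <= C)%E) ->
  (\int[mu]_(x in D) (f x)%:E <= C)%E.
Proof.
move=> mD mf f0 ff hC.
have := @fatou _ _ _ mu D mD (fun n x => (f_ n x)%:E)
  (fun n => (measurable_EFinP _ _).2 (mf n)) (fun n x Dx => f0 n x Dx).
rewrite (eq_integral (fun x => (f x)%:E)) => [h|x /set_mem Dx]; last first.
  have c : (f_ n x)%:E @[n --> \oo] --> (f x)%:E.
    by apply: cvg_EFin; [exact: nearW|exact: ff].
  by rewrite is_cvg_limn_einfE; [apply/cvg_lim|apply/cvg_ex; exists (f x)%:E].
apply: (le_trans h); rewrite limn_einf_lim; apply: lime_le; first exact: is_cvg_einfs.
apply: nearW => n; apply: le_trans (hC n); apply: ereal_inf_lbound.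
by exists n => /=.
Qed.

Lemma tball_measurable (R : realType) (m : nat) : measurable (@tball R m).
Proof. by apply: open_rv_measurable; exact: eball_open. Qed.

Lemma integral_tball (R : realType) (m : nat) (mu : {measure set (m.-tuple R) -> \bar R})
    (g : 'rV[R]_m -> R) :
  (forall x, ~ eball x -> g x = 0) ->
  (\int[mu]_(t in @tball R m) (g (rv_of_tuple t))%:E =
   \int[mu]_t (g (rv_of_tuple t))%:E)%E.
Proof.
move=> g0; rewrite integral_mkcond; apply: eq_integral => t _.
rewrite patchE; case: ifPn => //; rewrite notin_setE => h.
by rewrite g0.
Qed.

Lemma enorm_continuous (R : realType) (m : nat) : continuous (@enorm R m).
Proof.
move=> x; apply: (@continuous_comp _ _ _ (@normsq R m) (@Num.sqrt R)).
  exact: normsq_continuous.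
exact: sqrt_continuous.
Qed.

(** * Comparison of the weights *)

Lemma normsq_ge0 (R : realType) (m : nat) (x : 'rV[R]_m) : 0 <= normsq x.
Proof. by apply: sumr_ge0 => i _; exact: sqr_ge0. Qed.

(** From 1 - |x|^2 = (1 - |x|)(1 + |x|) with 1 <= 1 + |x| <= 2; this passes between the weight of
    the Bergman space and that of the Laplacian integral. *)
Lemma one_sub_enorm (R : realType) (m : nat) (x : 'rV[R]_m) : eball x ->
  0 <= 1 - enorm x /\ 1 - enorm x <= 1 - normsq x <= 2 * (1 - enorm x).
Proof.
move=> xb.
have e0 : 0 <= enorm x by exact: sqrtr_ge0.
have eE : enorm x ^+ 2 = normsq x by rewrite sqr_sqrtr ?normsq_ge0.
have e1 : enorm x <= 1 by rewrite -(@ler_pXn2r _ 2)// ?nnegrE// eE expr1n ltW.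
split; first by rewrite subr_ge0.
by rewrite -eE; apply/andP; split; nra.
Qed.

(** The subtracted term of [wgt] is nonnegative and is dropped. In the other, 4b(b-1) <=
    4(alpha+1)alpha, and the power is at most (1 - |x|^2)^(alpha-2). The bound is independent of b
    and r. *)
Lemma wgt_le (R : realType) (m : nat) (alpha b r : R) (x : 'rV[R]_m) :
  2 <= alpha -> alpha <= b -> 2 < b -> b <= alpha + 1 -> r < 1 -> eball x ->
  wgt b r x <=
  4 * (alpha + 1) * alpha * 2 `^ (alpha - 2) * (1 - enorm x) `^ (alpha - 2).
Proof.
move=> a2 ab b2 ba r1 xb.
have [e0 /andP[_ ne]] := one_sub_enorm xb.
have n0 := normsq_ge0 x; have n1 : normsq x < 1 by exact: xb.
have a20 : 0 <= alpha - 2 by lra.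
have hP : ppow (b - 2) (r - normsq x) <= 2 `^ (alpha - 2) * (1 - enorm x) `^ (alpha - 2).
  apply: (@le_trans _ _ ((1 - normsq x) `^ (alpha - 2))).
    by apply: ppow_le_powR; lra.
  rewrite -powRM//.
  by apply: ge0_ler_powR => //; rewrite nnegrE; [lra|rewrite mulr_ge0].
have P0 := ppow_ge0 (b - 2) (r - normsq x).
have Q0 := ppow_ge0 (b - 1) (r - normsq x).
rewrite /wgt -[leRHS]mulrA.
apply: (@le_trans _ _ (4 * b * (b - 1) * normsq x * ppow (b - 2) (r - normsq x))).
  by rewrite lerBlDr lerDl mulr_ge0// mulr_ge0// ?mulr_ge0//; lra.
apply: ler_pM => //; first by rewrite !mulr_ge0//; lra.
apply: (@le_trans _ _ (4 * b * (b - 1))).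
  apply: ler_piMr; last exact: ltW.
  by rewrite !mulr_ge0//; lra.
by apply: ler_pM; [rewrite mulr_ge0//; lra|lra|lra|lra].
Qed.

(** The numbers F and M stand for the value of the function at x and a bound for it on |x|^2 <= 1 -
    2/K. The constant K dominates 4b(b-1) + 2mb for all b <= alpha + 1, so the error K M is the same
    for all b and r. *)
Lemma wgt_ge (R : realType) (m : nat) (alpha b r M F : R) (x : 'rV[R]_m) :
  let K := 4 * (alpha + 1) * alpha + 2 * m%:R * (alpha + 1) in
  2 <= alpha -> alpha <= b -> 2 < b -> b <= alpha + 1 -> 1 / 2 <= r -> r < 1 ->
  0 <= F -> 0 <= M -> (normsq x <= 1 - 2 / K -> F <= M) ->
  2 * ppow (b - 2) (r - normsq x) * F <= wgt b r x * F + K * M.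
Proof.
move=> K a2 ab b2 ba r12 r1 F0 M0 FM.
have m0 : 0 <= (m%:R : R) by exact: ler0n.
have K0 : 0 < K.
  by rewrite /K ltr_pwDl// ?mulr_gt0 ?mulr_ge0//; lra.
have KM0 : 0 <= K * M by rewrite mulr_ge0// ltW.
have b20 : 0 < b - 2 by lra.
have b10 : 0 < b - 1 by lra.
have n0 := normsq_ge0 x.
have [t0|t0] := leP (r - normsq x) 0.
  by rewrite /wgt !ppow_neg ?gt_eqF// !mulr0 subr0 !mul0r add0r.
have QE : ppow (b - 1) (r - normsq x) = (r - normsq x) * ppow (b - 2) (r - normsq x).
  rewrite !ppow_pos ?ltW//.
  by rewrite (_ : b - 2 = (b - 1) - 1) ?mulr_powRB1 ?ltW//; ring.
have t1 : r - normsq x <= 1 by lra.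
rewrite /wgt QE.
have P0 := ppow_ge0 (b - 2) (r - normsq x).
have P1 := ppow_le1 b20 t1.
set P := ppow _ _ in P0 P1 *.
have tE : normsq x = r - (r - normsq x) by lra.
set t := r - normsq x in t0 t1 tE QE *.
have r0 : 0 <= r by lra.
have c4 : 4 <= 4 * b * (b - 1) * r.
  have bb : 2 <= b * (b - 1).
    (* This is (b - 2)(b + 1) >= 0 expanded. *)
    by have := mulr_ge0 (ltW b20) (addr_ge0 (ltW b20) (ler0n R 3)); lra.
  have := ler_wpM2r r0 bb; lra.
have cK : 4 * b * (b - 1) + 2 * m%:R * b <= K.
  have h1 : b * (b - 1) <= (alpha + 1) * alpha by apply: ler_pM; lra.
  have h2 := ler_wpM2l m0 ba; rewrite /K; lra.
(* After substituting |x|^2 = r - t, the coefficient of P is affine in t: its constant term is at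
   least 4, its slope at least -K. *)
have step : (4 - K * t) * P <=
    4 * b * (b - 1) * normsq x * P - 2 * m%:R * b * (t * P).
  have : 4 - K * t <= 4 * b * (b - 1) * r - (4 * b * (b - 1) + 2 * m%:R * b) * t by nra.
  move/(ler_wpM2r P0)/le_trans; apply; rewrite tE le_eqVlt; apply/orP; left.
  by apply/eqP; ring.
apply: (@le_trans _ _ ((4 - K * t) * P * F + K * M)); last first.
  by rewrite lerD2r ler_wpM2r.
(* Either t = r - |x|^2 is so small that the first term of lap rho dominates,
   or x stays away from the sphere and F x <= M. *)
have [Kt|Kt] := leP (K * t) 2.
  have : 0 <= (2 - K * t) * P * F by rewrite !mulr_ge0// subr_ge0.
  lra.
have FM' : F <= M.
  apply: FM; have : 2 / K < t by rewrite ltr_pdivrMr// mulrC.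
  lra.
have tP1 : t * P <= 1 by rewrite mulr_ile1// ltW.
have : (t * P) * F <= M.
  by apply: le_trans FM'; rewrite ler_piMl.
move/(ler_wpM2l (ltW K0)).
have : 0 <= P * F by rewrite mulr_ge0.
lra.
Qed.

Lemma closed_ball_bounded (R : realType) (m : nat) (F : 'rV[R]_m -> R) (c : R) :
  c < 1 -> (forall x, eball x -> {for x, continuous F}) ->
  exists2 M, 0 <= M & forall x, normsq x <= c -> F x <= M.
Proof.
move=> c1 cF.
pose C : set 'rV[R]_m := [set x | normsq x <= c].
have Cb x : C x -> eball x by move=> xC; exact: le_lt_trans c1.
have cC : compact C.
  apply: (@subclosed_compact _ _ [set x : 'rV[R]_m | forall i, x ord0 i \in `[(- 1), 1]]).
  - rewrite (_ : C = @normsq R m @^-1` [set y | y <= c])//.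
    by apply: closed_comp; [move=> x _; exact: normsq_continuous|exact: closed_le].
  - apply: (@rV_compact R _ (fun=> `[(- 1), 1]%classic)) => _.
    exact: segment_compact.
  - move=> x /Cb xb i; rewrite /= in_itv /= -ler_norml leNgt; apply/negP => /normsq_gt1.
    by rewrite ltNge ltW.
have /compact_bounded[M [Mr hM]] : compact (F @` C).
  apply: continuous_compact => //; apply: continuous_in_subspaceT => x.
  by rewrite inE => /Cb; exact: cF.
exists (`|M| + 1) => [|x xC]; first by rewrite addr_ge0.
apply: le_trans (ler_norm _) _; apply: (hM (`|M| + 1)); last by exists x.
by rewrite (le_lt_trans (ler_norm M))// ltrDl.
Qed.

(** Radii increasing to 1, with denominator k + 2 so that the first one is 1/2, the least radius
    allowed by [wgt_ge]. *)
Definition rad_seq (R : realType) (k : nat) : R := 1 - k.+2%:R^-1.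

(** Exponents in the interval from alpha, excluded, to alpha + 1, included; hence they exceed 2 even
    for alpha = 2. *)
Definition expo_seq (R : realType) (alpha : R) (k : nat) : R := alpha + k.+1%:R^-1.

Lemma rad_bounds (R : realType) (k : nat) : 1 / 2 <= rad_seq R k /\ rad_seq R k < 1.
Proof.
have h : 0 < (k.+2%:R^-1 : R) by rewrite invr_gt0.
have h2 : (k.+2%:R^-1 : R) <= 2^-1 by rewrite lef_pV2 ?posrE// ler_nat.
by rewrite /rad_seq; move: (k.+2%:R^-1 : R) h h2 => d h h2; split; lra.
Qed.

Lemma expo_bounds (R : realType) (alpha : R) (k : nat) :
  alpha < expo_seq alpha k /\ expo_seq alpha k <= alpha + 1.
Proof.
have h : 0 < (k.+1%:R^-1 : R) by rewrite invr_gt0.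
have h2 : (k.+1%:R^-1 : R) <= 1 by rewrite invf_le1// ler1n.
by rewrite /expo_seq; move: (k.+1%:R^-1 : R) h h2 => d h h2; split; lra.
Qed.

Lemma rad_cvg (R : realType) : rad_seq R k @[k --> \oo] --> (1 : R).
Proof.
rewrite -[X in _ --> X]subr0; apply: cvgB; first exact: cvg_cst.
by have h := @cvg_harmonic R; rewrite -cvg_shiftS in h; exact: h.
Qed.

Lemma expo_cvg (R : realType) (alpha : R) : expo_seq alpha k @[k --> \oo] --> alpha.
Proof.
rewrite -[X in _ --> X]addr0; apply: cvgD; first exact: cvg_cst.
exact: cvg_harmonic.
Qed.

Lemma ppow_rad_cvg (R : realType) (m : nat) (c alpha : R) (x : 'rV[R]_m) :
  eball x ->
  ppow (expo_seq alpha k - c) (rad_seq R k - normsq x) @[k --> \oo] -->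
  (1 - normsq x) `^ (alpha - c).
Proof.
move=> xb; apply: ppow_cvg; first by rewrite subr_gt0.
  by apply: cvgB; [exact: expo_cvg|exact: cvg_cst].
by apply: cvgB; [exact: rad_cvg|exact: cvg_cst].
Qed.

(** * Measurability and Green's identity on the ball *)

Lemma continuous_ball_measurable (R : realType) (m : nat) (g : 'rV[R]_m -> R) :
  (forall x, eball x -> {for x, continuous g}) ->
  measurable_fun (@tball R m) (g \o @rv_of_tuple R m).
Proof. by apply: continuous_rv_measurable; exact: eball_open. Qed.

Lemma lap_continuous (R : realType) (m : nat) (F : 'rV[R]_m -> R) (x : 'rV[R]_m) :
  C2_axis F -> eball x -> {for x, continuous (lap F)}.
Proof.
move=> hF xb; apply: continuous_bigsum => i.
by have [_ /(_ i)[]] := hF x xb.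
Qed.

Lemma powR_weight_measurable (R : realType) (m : nat) (w : 'rV[R]_m -> R) (a : R) :
  continuous w ->
  measurable_fun (@tball R m) (fun t => (1 - w (rv_of_tuple t)) `^ a).
Proof.
move=> cw; apply: (measurableT_comp (measurable_powR a)).
apply: (continuous_ball_measurable (g := fun x => 1 - w x)) => x _.
by apply: continuous_sub; [exact: continuous_const|exact: cw].
Qed.

Lemma green_ball (R : realType) (m : nat) (mu : {measure set (m.-tuple R) -> \bar R})
    (F : 'rV[R]_m -> R) (b r : R) :
  is_dVN mu -> C2_axis F -> 2 < b -> r < 1 ->
  (\int[mu]_(t in @tball R m) (rho b r (rv_of_tuple t) * lap F (rv_of_tuple t))%:E =
   \int[mu]_(t in @tball R m) (wgt b r (rv_of_tuple t) * F (rv_of_tuple t))%:E)%E.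
Proof.
move=> dmu hF b2 r1.
have out (x : 'rV[R]_m) : ~ eball x -> r <= normsq x.
  by move=> /negP; rewrite -leNgt; apply: le_trans; exact: ltW.
rewrite (integral_tball mu (g := fun x => rho b r x * lap F x)); last first.
  by move=> x /out h; rewrite rho_supp// mul0r.
rewrite (integral_tball mu (g := fun x => wgt b r x * F x)); first exact: green.
move=> x /out h; rewrite wgtE big1 ?mul0r// => i _; exact: ddrho_supp.
Qed.

(** The weight [wgt] may change sign, so comparing and adding its integrals calls for integrability
    rather than nonnegativity. *)
Lemma wgt_integrable (R : realType) (m : nat)
    (mu : {measure set (m.-tuple R) -> \bar R}) (F : 'rV[R]_m -> R) (b r : R) :
  is_dVN mu -> C2_axis F -> 2 < b -> r < 1 ->
  mu.-integrable (@tball R m)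
    (fun t => (wgt b r (rv_of_tuple t) * F (rv_of_tuple t))%:E).
Proof.
move=> dmu hF b2 r1.
apply: (@integrableS _ _ _ mu setT) => //; first exact: tball_measurable.
have w0 (x : 'rV[R]_m) : r <= normsq x -> wgt b r x = 0.
  by move=> h; rewrite wgtE big1// => i _; exact: ddrho_supp.
apply: (@continuous_supp_integrable _ _ _ (fun x : 'rV[R]_m => wgt b r x * F x) 1 dmu).
  apply: (@cutoff_continuous R m (wgt b r) F r) => //; last by move=> x /hF[].
  rewrite (_ : wgt b r = fun x : 'rV[R]_m => \sum_(i < m) ddrho b r i x); last first.
    by apply/funext => x; rewrite wgtE.
  by move=> x; apply: continuous_bigsum => i; exact: ddrho_continuous.
move=> x j /normsq_gt1 h.
by rewrite (w0 x (le_trans (ltW r1) (ltW h))) mul0r.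
Qed.

(** By Fatou it suffices to bound the integrals of rho lap F along the sequences. Green's identity
    turns them into integrals of wgt F, and [wgt_le] bounds these by a fixed multiple C of the
    Bergman integral. *)
Lemma lap_integral_finite (R : realType) (m : nat)
    (mu : {measure set (m.-tuple R) -> \bar R}) (F : 'rV[R]_m -> R) (alpha : R) :
  is_dVN mu -> C2_axis F -> (forall x, 0 <= F x) ->
  (forall x, eball x -> 0 <= lap F x) -> 2 <= alpha ->
  (\int[mu]_(t in @tball R m) (((1 - enorm (rv_of_tuple t)) `^ (alpha - 2)) *
     F (rv_of_tuple t))%:E < +oo)%E ->
  (\int[mu]_(t in @tball R m) (((1 - normsq (rv_of_tuple t)) `^ alpha) *
     lap F (rv_of_tuple t))%:E < +oo)%E.
Proof.
move=> dmu hF F0 L0 a2 J.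
have mB := @tball_measurable R m.
have cF x : eball x -> {for x, continuous F} by move=> /hF[].
have mF := continuous_ball_measurable cF.
have mL := continuous_ball_measurable (fun x => lap_continuous hF).
pose g t := (1 - enorm (rv_of_tuple t)) `^ (alpha - 2) * F (@rv_of_tuple R m t).
have g0 t : 0 <= g t by rewrite mulr_ge0 ?powR_ge0.
have mg : measurable_fun (@tball R m) g.
  apply: measurable_funM => //; apply: powR_weight_measurable.
  exact: enorm_continuous.
have ig : mu.-integrable (@tball R m) (EFin \o g).
  apply/integrableP; split; first exact/measurable_EFinP.
  by under eq_integral do rewrite /= ger0_norm//.
pose C := 4 * (alpha + 1) * alpha * 2 `^ (alpha - 2).
apply: (@le_lt_trans _ _ (C%:E * \int[mu]_(t in @tball R m) (g t)%:E)%E); last first.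
  by rewrite lte_mul_pinfty// lee_fin /C !mulr_ge0 ?powR_ge0//; lra.
apply: (@fatou_le _ _ _ mu _ (fun k t => rho (expo_seq alpha k) (rad_seq R k) (rv_of_tuple t) *
  lap F (rv_of_tuple t))
  (fun t => (1 - normsq (rv_of_tuple t)) `^ alpha * lap F (rv_of_tuple t))) => //.
- move=> k; apply: measurable_funM => //; apply: continuous_ball_measurable => x _.
  have [e1 e2] := expo_bounds alpha k; apply: rho_continuous; lra.
- by move=> k t tb; rewrite mulr_ge0 ?ppow_ge0// L0.
- move=> t tb; apply: cvgM; last exact: cvg_cst.
  have := @ppow_rad_cvg R m 0 alpha _ tb; rewrite subr0.
  by under eq_fun do rewrite subr0.
move=> k; have [e1 e2] := expo_bounds alpha k; have [r1 r2] := rad_bounds R k.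
have b2 : 2 < expo_seq alpha k by lra.
rewrite green_ball// -integralZl//; apply: (le_integral mB).
- exact: wgt_integrable.
- exact: integrableZl.
move=> t /set_mem tb; rewrite -EFinM lee_fin /g mulrA ler_wpM2r//.
by apply: wgt_le => //; exact: ltW.
Qed.

(** By [wgt_ge], twice the approximating Bergman integral is at most the integral of wgt F plus K M,
    the ball having measure 1. Green's identity and the bound of rho by (1 - |x|^2)^alpha replace
    the former by the given finite integral, and Fatou concludes. *)
Lemma bergman_integral_finite (R : realType) (m : nat)
    (mu : {measure set (m.-tuple R) -> \bar R}) (F : 'rV[R]_m -> R) (alpha : R) :
  is_dVN mu -> C2_axis F -> (forall x, 0 <= F x) ->
  (forall x, eball x -> 0 <= lap F x) -> 2 <= alpha ->
  (\int[mu]_(t in @tball R m) (((1 - normsq (rv_of_tuple t)) `^ alpha) *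
     lap F (rv_of_tuple t))%:E < +oo)%E ->
  (\int[mu]_(t in @tball R m) (((1 - enorm (rv_of_tuple t)) `^ (alpha - 2)) *
     F (rv_of_tuple t))%:E < +oo)%E.
Proof.
move=> dmu hF F0 L0 a2 I.
have mB := @tball_measurable R m.
have [muB _] := dmu.
have cF x : eball x -> {for x, continuous F} by move=> /hF[].
have mF := continuous_ball_measurable cF.
have mL := continuous_ball_measurable (fun x => lap_continuous hF).
pose K := 4 * (alpha + 1) * alpha + 2 * m%:R * (alpha + 1).
have K0 : 0 < K.
  have m0 : 0 <= (m%:R : R) by exact: ler0n.
  by rewrite /K ltr_pwDl// ?mulr_gt0 ?mulr_ge0//; lra.
have d1 : 1 - 2 / K < 1 by rewrite ltrBlDr ltrDl divr_gt0.
have [M M0 FM] := closed_ball_bounded d1 cF.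
set I0 := (\int[mu]_(t in _) _)%E in I.
apply: (@le_lt_trans _ _ (I0 + (K * M)%:E)%E); last by rewrite lte_add_pinfty// ltry.
(* The harmless factor 2 is inserted to match the left side of [wgt_ge]. *)
apply: (@le_trans _ _ (\int[mu]_(t in @tball R m)
    (2 * (1 - normsq (rv_of_tuple t)) `^ (alpha - 2) * F (rv_of_tuple t))%:E)%E).
  apply: ge0_le_integral => //.
  - by move=> t _; rewrite lee_fin mulr_ge0 ?powR_ge0.
  - apply/measurable_EFinP; apply: measurable_funM => //.
    by apply: powR_weight_measurable; exact: enorm_continuous.
  - apply/measurable_EFinP; apply: measurable_funM => //.
    apply: measurable_funM => //.
    by apply: powR_weight_measurable; exact: normsq_continuous.
  move=> t tb; rewrite lee_fin ler_wpM2r//.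
  have [e0 /andP[e1 _]] := one_sub_enorm tb.
  have n1 : 0 <= 1 - normsq (rv_of_tuple t) by exact: le_trans e1.
  apply: (@le_trans _ _ ((1 - normsq (rv_of_tuple t)) `^ (alpha - 2))).
    by apply: ge0_ler_powR => //; lra.
  by rewrite ler_peMl ?powR_ge0// ler1n.
apply: (@fatou_le _ _ _ mu _ (fun k t =>
  2 * ppow (expo_seq alpha k - 2) (rad_seq R k - normsq (rv_of_tuple t)) *
  F (rv_of_tuple t))
  (fun t => 2 * (1 - normsq (rv_of_tuple t)) `^ (alpha - 2) * F (rv_of_tuple t))) => //.
- move=> k; apply: measurable_funM => //; apply: measurable_funM => //.
  apply: (continuous_ball_measurable
    (g := fun x => ppow (expo_seq alpha k - 2) (rad_seq R k - normsq x))) => x _.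
  have [e1 e2] := expo_bounds alpha k; apply: ppow_rho_continuous; lra.
- by move=> k t tb; rewrite mulr_ge0// mulr_ge0 ?ppow_ge0.
- move=> t tb; apply: cvgM; last exact: cvg_cst.
  apply: cvgM; first exact: cvg_cst.
  exact: ppow_rad_cvg.
move=> k; have [e1 e2] := expo_bounds alpha k; have [r1 r2] := rad_bounds R k.
have b2 : 2 < expo_seq alpha k by lra.
have iw := wgt_integrable dmu hF b2 r2.
have iK : mu.-integrable (@tball R m) (EFin \o cst (K * M)).
  apply: (measurable_bounded_integrable mB) => //; first by rewrite muB ltry.
  exact: bounded_cst.
apply: (@le_trans _ _ (\int[mu]_(t in @tball R m)
  ((wgt (expo_seq alpha k) (rad_seq R k) (rv_of_tuple t) * F (rv_of_tuple t))%:E +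
   (K * M)%:E))%E).
  apply: ge0_le_integral => //.
  - by move=> t _; rewrite lee_fin mulr_ge0// mulr_ge0 ?ppow_ge0.
  - apply/measurable_EFinP; apply: measurable_funM => //; apply: measurable_funM => //.
    apply: (continuous_ball_measurable
      (g := fun x => ppow (expo_seq alpha k - 2) (rad_seq R k - normsq x))) => x _.
    by apply: ppow_rho_continuous; lra.
  - apply: emeasurable_funD; first exact: measurable_int iw.
    exact: measurable_cst.
  move=> t tb; rewrite -EFinD lee_fin.
  by apply: wgt_ge => //; [exact: ltW|exact: FM].
rewrite (integralD mB iw iK).
have -> : (\int[mu]_(t in @tball R m) (EFin \o cst (K * M)%R) t = (K * M)%:E)%E.
  by have := integral_cst mu mB (K * M)%:E; rewrite muB mule1.
rewrite leeD2r//.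
(* Since lap F >= 0, the approximating integrals compare pointwise with the limit one: rho <= (1 -
   |x|^2)^alpha because the exponent exceeds alpha and r < 1. *)
rewrite -green_ball//; apply: ge0_le_integral => //.
- by move=> t tb; rewrite lee_fin mulr_ge0 ?ppow_ge0// L0.
- apply/measurable_EFinP; apply: measurable_funM => //.
  by apply: continuous_ball_measurable => x _; exact: rho_continuous.
- apply/measurable_EFinP; apply: measurable_funM => //.
  by apply: powR_weight_measurable; exact: normsq_continuous.
move=> t tb; rewrite lee_fin ler_wpM2r ?L0//.
have n0 := normsq_ge0 (rv_of_tuple t).
have n1 : normsq (rv_of_tuple t) < 1 by exact: tb.
by apply: ppow_le_powR; lra.
Qed.

Unset Implicit Arguments.

Theorem theorem1p5 (R : realType) (n : nat) (hn : (0 < n)%N)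
    (mu : {measure set ((2 * n)%N.-tuple R) -> \bar R})
    (hmu : is_dVN mu)
    (u v : 'rV[R]_(2 * n) -> R)
    (hu : C2_on (@eball R _) u) (hv : C2_on (@eball R _) v)
    (hf : forall x, eball x -> 0 <= u x * lap u x + v x * lap v x)
    (p alpha : R) (hp : 2 <= p) (halpha : 2 <= alpha) :
  (\int[mu]_(t in @tball R (2 * n))
      (((1 - normsq (rv_of_tuple t)) `^ alpha) *
        lap (fun x => cabs u v x `^ p) (rv_of_tuple t))%:E < +oo)%E
  <-> in_b mu (alpha - 2) p u v.
Proof.
(* Only here does the sign condition on f enter, through the nonnegativity of the Laplacian of
   |f|^p. *)
have [hF L0] := cabs_pow_C2_axis hp (C2_on_axis hu) (C2_on_axis hv) hf.
have F0 (x : 'rV[R]_(2 * n)) : 0 <= cabs u v x `^ p by exact: powR_ge0.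
split => [I|[_ J]]; last exact: lap_integral_finite J.
split; last exact: bergman_integral_finite I.
by move=> x xb; have [cu _ _] := hu x xb; have [cv _ _] := hv x xb.
Qed.
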